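(* Let $\mathcal{F}:=\bigoplus_{k=1}^\infty\mathcal{F}_{k,k}$, a quasi-coherent locally free sheaf of infinite rank on $\mathbb{R}^2$, where $\mathcal{F}_{k,k}$ are the rank-one locally free sheaves defined in the context. Then for any multi-blowup $\alpha:X_\alpha\to\mathbb{R}^2$ the pull-back $\alpha^*\mathcal{F}$ is not generated by global sections.
   Context: $\mathbb{R}^2$ is regarded as a real algebraic variety with the Zariski topology and the sheaf $\mathcal{O}$ of (real-valued) regular functions. For $k,l\in\mathbb{N}$ let $P_{k,l}(x,y)=x^{2k}(x-1)^{2l}+y^2$, let $c_1=(0,0)$, $c_2=(1,0)$ and $U_i=\mathbb{R}^2\setminus\{c_i\}$, $i=1,2$. Let $\xi_{k,l}$ be the line bundle on $\mathbb{R}^2$ obtained by gluing trivial line bundles on $U_1$ and $U_2$ via the transition function $g_{2,1}=P_{k,l}:U_1\cap U_2\to\mathbb{R}^*$, and $\mathcal{F}_{k,l}$ its sheaf of sections: for $V$ Zariski open, $\mathcal{F}_{k,l}(V)$ is the set of pairs $(s_1,s_2)$ with $s_i\in\mathcal{O}(U_i\cap V)$ and $P_{k,l}\,s_1=s_2$ on $U_1\cap U_2\cap V$. A multi-blowup is a finite composition of blowups along smooth centres. A sheaf is quasi-coherent if on the members of some finite Zariski open covering it is the cokernel of a homomorphism between direct sums (over arbitrary index sets) of copies of the structure sheaf. A sheaf of modules is generated by global sections if each stalk is generated, as a module over the local ring, by the germs of global sections. *)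

(* Defs.v *)
From HB Require Import structures.
From mathcomp Require Import all_boot all_order all_algebra.
From mathcomp Require Import boolp classical_sets functions cardinality reals.
From mathcomp Require Import mpoly.
Set Implicit Arguments.
Unset Strict Implicit.
Unset Printing Implicit Defensive.
Import Order.TTheory GRing.Theory Num.Theory.
Local Open Scope ring_scope.
Local Open Scope quotient_scope.
Local Open Scope classical_set_scope.

(* Spaces with functions: topological spaces with a sheaf of real-valued      *)
(* functions.  [zregular U f] only concerns the values of [f] on [U].         *)
Record rspace (R : realType) := RSpace {
  pt :> Type;
  zopen : set (set pt);
  zregular : set pt -> set (pt -> R);
  zopenT : zopen setT;
  zopenI : forall U V, zopen U -> zopen V -> zopen (U `&` V);
  zopenU : forall D : set (set pt),
    D `<=` zopen -> zopen (\bigcup_(U in D) U);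
  zregular_sub : forall U V f, zopen U -> zopen V -> V `<=` U ->
    zregular U f -> zregular V f;
  zregular_local : forall U f, zopen U ->
    (forall x, U x -> exists V g,
      [/\ zopen V, V x, V `<=` U, zregular V g & forall y, V y -> f y = g y]) ->
    zregular U f;
  zregular_cst : forall U c, zopen U -> zregular U (fun=> c);
  zregularB : forall U f g, zopen U -> zregular U f -> zregular U g ->
    zregular U (fun x => f x - g x);
  zregularM : forall U f g, zopen U -> zregular U f -> zregular U g ->
    zregular U (fun x => f x * g x) }.

Section Opens.
Variables (R : realType) (X : rspace R).

Record opens := Opens { oset :> set X; opensP : zopen oset }.

Definition openT : opens := Opens (@zopenT R X).
Definition openI (U V : opens) : opens := Opens (zopenI (opensP U) (opensP V)).

Lemma openIl (U V : opens) : openI U V `<=` U. Proof. by move=> x []. Qed.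
Lemma openIr (U V : opens) : openI U V `<=` V. Proof. by move=> x []. Qed.
Lemma openI_mem (U V : opens) x : oset U x -> oset V x -> oset (openI U V) x.
Proof. by []. Qed.

Lemma zregular_ext (U : opens) f g : zregular U g ->
  (forall x, oset U x -> f x = g x) -> zregular U f.
Proof.
move=> hg e; apply: zregular_local; first exact: opensP.
by move=> x Ux; exists U, g; split => //; exact: opensP.
Qed.

(* The ring O(U): a regular function on U is represented by its extension by  *)
(* zero outside U.                                                            *)
Definition regfun_pred (U : opens) : {pred X -> R} :=
  [pred f : X -> R | `[< zregular U f /\ forall x, ~ oset U x -> f x = 0 >]].

Record regfun (U : opens) :=
  RegFun { regfun_fun :> X -> R; regfunP : regfun_fun \in regfun_pred U }.

End Opens.

HB.instance Definition _ (R : realType) (X : rspace R) (U : opens X) :=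
  [isSub for @regfun_fun R X U].
HB.instance Definition _ (R : realType) (X : rspace R) (U : opens X) :=
  [Choice of regfun U by <:].

Section Regfun.
Variables (R : realType) (X : rspace R).
Implicit Types U V : opens X.

Fact regfun_zmod_closed U : zmod_closed (regfun_pred U).
Proof.
split; first by apply/asboolP; split => //; apply: zregular_cst; exact: opensP.
move=> f g /asboolP[rf f0] /asboolP[rg g0]; apply/asboolP; split.
  by apply: (zregularB (opensP U) rf rg).
by move=> x Ux; rewrite !fctE f0 // g0 // subr0.
Qed.
HB.instance Definition _ U :=
  GRing.isZmodClosed.Build (X -> R) (regfun_pred U) (regfun_zmod_closed U).
HB.instance Definition _ U := [SubChoice_isSubZmodule of regfun U by <:].

Lemma regfun_reg U (f : regfun U) : zregular U f.
Proof. by case: f => f /= /asboolP[]. Qed.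
Lemma regfun_out U (f : regfun U) x : ~ oset U x -> f x = 0.
Proof. by case: f => f /= /asboolP[_]; apply. Qed.

Lemma regfun_eqP U (f g : regfun U) :
  (forall x, oset U x -> f x = g x) -> f = g.
Proof.
move=> e; apply: val_inj; apply: funext => x /=.
by case: (pselect (oset U x)) => Ux; [exact: e | rewrite !regfun_out].
Qed.

Lemma mkregfun_subproof U f : zregular U f -> patch (cst 0) U f \in regfun_pred U.
Proof.
move=> rf; apply/asboolP; split; last by move=> x Ux; rewrite patchN// notin_setE.
by apply: (zregular_ext rf) => x Ux; rewrite patchT// inE.
Qed.
Definition mkregfun U f (rf : zregular U f) : regfun U :=
  RegFun (mkregfun_subproof rf).

Lemma mkregfunE U f (rf : zregular U f) x : oset U x -> mkregfun rf x = f x.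
Proof. by move=> Ux /=; rewrite patchT// inE. Qed.

Definition regfun1 U : regfun U := mkregfun (zregular_cst 1 (opensP U)).
Definition regfunM U (f g : regfun U) : regfun U :=
  mkregfun (zregularM (opensP U) (regfun_reg f) (regfun_reg g)).

Lemma regfunD_val U (f g : regfun U) x : (f + g) x = f x + g x.
Proof. by []. Qed.
Lemma regfunB_val U (f g : regfun U) x : (f - g) x = f x - g x.
Proof. by []. Qed.
Lemma regfunME U (f g : regfun U) x : regfunM f g x = f x * g x.
Proof.
case: (pselect (oset U x)) => Ux; first by rewrite mkregfunE.
by rewrite !regfun_out // mulr0.
Qed.
Lemma regfun1E U x : oset U x -> regfun1 U x = 1.
Proof. by move=> Ux; rewrite mkregfunE. Qed.

Fact regfunMA U : associative (@regfunM U).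
Proof. by move=> f g h; apply: regfun_eqP => x _; rewrite !regfunME mulrA. Qed.
Fact regfunMC U : commutative (@regfunM U).
Proof. by move=> f g; apply: regfun_eqP => x _; rewrite !regfunME mulrC. Qed.
Fact regfunM1 U : left_id (regfun1 U) (@regfunM U).
Proof.
by move=> f; apply: regfun_eqP => x Ux; rewrite regfunME regfun1E // mul1r.
Qed.
Fact regfunMD U : left_distributive (@regfunM U) +%R.
Proof.
by move=> f g h; apply: regfun_eqP => x _; rewrite !(regfunME, regfunD_val) mulrDl.
Qed.
HB.instance Definition _ U := GRing.Zmodule_isComPzRing.Build (regfun U)
  (@regfunMA U) (@regfunMC U) (@regfunM1 U) (@regfunMD U).

Lemma regfun_mulE U (f g : regfun U) x : (f * g) x = f x * g x.
Proof. exact: regfunME. Qed.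
Lemma regfun_oneE U x : oset U x -> (1 : regfun U) x = 1.
Proof. exact: regfun1E. Qed.

Definition rrestr U V (h : V `<=` U) (f : regfun U) : regfun V :=
  mkregfun (zregular_sub (opensP U) (opensP V) h (regfun_reg f)).
Lemma rrestrE U V (h : V `<=` U) (f : regfun U) x :
  oset V x -> rrestr h f x = f x.
Proof. by move=> Vx; rewrite mkregfunE. Qed.

End Regfun.

(* Sheaves of modules over the structure sheaf.  Families of sections are     *)
(* indexed by the members of the covering, which loses no generality since    *)
(* sections that agree on overlaps coincide on equal open sets.               *)
Record omod (R : realType) (X : rspace R) := OMod {
  sec :> forall U : opens X, lmodType (regfun U);
  res : forall U V : opens X, V `<=` U -> sec U -> sec V;
  resD : forall (U V : opens X) (h : V `<=` U) (s t : sec U),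
    res h (s + t) = res h s + res h t;
  resZ : forall (U V : opens X) (h : V `<=` U) (a : regfun U) (s : sec U),
    res h (a *: s) = rrestr h a *: res h s;
  res_id : forall (U : opens X) (h : U `<=` U) (s : sec U), res h s = s;
  res_comp : forall (U V W : opens X) (h : V `<=` U) (h' : W `<=` V) (h'' : W `<=` U)
    (s : sec U), res h' (res h s) = res h'' s;
  sheaf_sep : forall (U : opens X) (D : set (opens X)) (s t : sec U),
    (forall V, D V -> V `<=` U) ->
    (forall x, oset U x -> exists2 V, D V & oset V x) ->
    (forall (V : opens X) (h : V `<=` U), D V -> res h s = res h t) -> s = t;
  sheaf_glue : forall (U : opens X) (D : set (opens X))
    (s : forall V, sec V),
    (forall V, D V -> V `<=` U) ->
    (forall x, oset U x -> exists2 V, D V & oset V x) ->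
    (forall V W, D V -> D W ->
      res (@openIl _ _ V W) (s V) = res (@openIr _ _ V W) (s W)) ->
    exists t : sec U, forall (V : opens X) (h : V `<=` U), D V -> res h t = s V }.

Section Structure.
Variables (R : realType) (X : rspace R).
Implicit Types U V W : opens X.

Lemma rrestrD U V (h : V `<=` U) (f g : regfun U) :
  rrestr h (f + g) = rrestr h f + rrestr h g.
Proof.
by apply: regfun_eqP => x Vx; rewrite regfunD_val !rrestrE.
Qed.
Lemma rrestrM U V (h : V `<=` U) (f g : regfun U) :
  rrestr h (f * g) = rrestr h f * rrestr h g.
Proof.
by apply: regfun_eqP => x Vx; rewrite regfun_mulE !rrestrE // regfun_mulE.
Qed.
Lemma rrestr1 U V (h : V `<=` U) : rrestr h 1 = 1.
Proof.
apply: regfun_eqP => x Vx; rewrite rrestrE // !regfun_oneE //; exact: h.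
Qed.
Lemma rrestr_id U (h : U `<=` U) (f : regfun U) : rrestr h f = f.
Proof. by apply: regfun_eqP => x Vx; rewrite !rrestrE. Qed.
Lemma rrestr_comp U V W (h : V `<=` U) (h' : W `<=` V) (h'' : W `<=` U)
  (f : regfun U) : rrestr h' (rrestr h f) = rrestr h'' f.
Proof.
by apply: regfun_eqP => x Wx; rewrite !rrestrE //; exact: h'.
Qed.

Lemma rrestr_sep U (D : set (opens X)) (s t : regfun U) :
  (forall V, D V -> V `<=` U) ->
  (forall x, oset U x -> exists2 V, D V & oset V x) ->
  (forall V (h : V `<=` U), D V -> rrestr h s = rrestr h t) -> s = t.
Proof.
move=> DU cov e; apply: regfun_eqP => x Ux; have [V DV Vx] := cov x Ux.
by rewrite -(rrestrE (DU _ DV) s Vx) (e V) // rrestrE.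
Qed.

Lemma rrestr_glue U (D : set (opens X)) (s : forall V, regfun V) :
  (forall V, D V -> V `<=` U) ->
  (forall x, oset U x -> exists2 V, D V & oset V x) ->
  (forall V W, D V -> D W ->
    rrestr (@openIl _ _ V W) (s V) = rrestr (@openIr _ _ V W) (s W)) ->
  exists t : regfun U, forall V (h : V `<=` U), D V -> rrestr h t = s V.
Proof.
move=> DU cov agr.
pose f x := if pselect (oset U x) is left Ux
            then s (projT1 (cid2 (cov x Ux))) x else 0.
have fE V x : D V -> oset V x -> f x = s V x.
  move=> DV Vx; rewrite /f; case: pselect => [Ux|]; last by case; exact: DU Vx.
  case: cid2 => W DW Wx /=; have /(congr1 (fun g : regfun _ => g x)) := agr _ _ DV DW.
  by rewrite !rrestrE.
have rf : zregular U f.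
  apply: zregular_local; first exact: opensP.
  move=> x /cov[V DV Vx]; exists V, (s V); split => //.
  - exact: opensP.
  - exact: DU.
  - exact: regfun_reg.
  - by move=> y; exact: fE.
exists (mkregfun rf) => V h DV; apply: regfun_eqP => x Vx.
by rewrite rrestrE // mkregfunE; [exact: fE | exact: h].
Qed.

Definition struct_sheaf : omod X := @OMod R X
  (fun U => (regfun U)^o) (@rrestr R X) rrestrD rrestrM rrestr_id rrestr_comp
  rrestr_sep rrestr_glue.

End Structure.

(* Stalks, as direct limits over the neighbourhoods of a point. *)
Section Stalk.
Variables (R : realType) (X : rspace R) (F : omod X) (x : X).

Record pregerm :=
  PreGerm { pg_open : opens X; pg_mem : oset pg_open x; pg_sec : F pg_open }.

Definition pregerm_eq (g h : pregerm) : Prop :=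
  exists (W : opens X) (hg : W `<=` pg_open g) (hh : W `<=` pg_open h),
    oset W x /\ res hg (pg_sec g) = res hh (pg_sec h).

HB.instance Definition _ := gen_eqMixin pregerm.
HB.instance Definition _ := gen_choiceMixin pregerm.

Definition pregerm_rel : rel pregerm := fun g h => `[< pregerm_eq g h >].

Fact pregerm_equiv : equiv_class_of pregerm_rel.
Proof.
split.
- move=> g; apply/asboolP; exists (pg_open g), (@subset_refl _ _), (@subset_refl _ _).
  by split => //; exact: pg_mem.
- move=> g h; apply/asboolP/asboolP => -[W [hg [hh [Wx e]]]];
  by exists W, hh, hg.
- move=> h g k /asboolP[W [hg [hh [Wx e]]]] /asboolP[W' [hh' [hk [W'x e']]]].
  apply/asboolP.
  have hW := @openIl _ _ W W'; have hW' := @openIr _ _ W W'.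
  exists (openI W W'), (subset_trans hW hg), (subset_trans hW' hk); split => //.
  by rewrite -(res_comp hg hW) e -(res_comp hk hW') -e' !(res_comp _ _ (subset_trans hW hh)).
Qed.

Canonical pregerm_equiv_rel := EquivRelPack pregerm_equiv.

Definition stalk := {eq_quot pregerm_rel}.
HB.instance Definition _ := Choice.on stalk.

Definition mkgerm (U : opens X) (Ux : oset U x) (s : F U) : stalk :=
  \pi_stalk (PreGerm Ux s).

Lemma mkgerm_eq (U V : opens X) (Ux : oset U x) (Vx : oset V x) s t :
  (mkgerm Ux s = mkgerm Vx t :> stalk) <->
  exists (W : opens X) (hU : W `<=` U) (hV : W `<=` V),
    oset W x /\ res hU s = res hV t.
Proof.
split; first by move=> /eqmodP /asboolP.
by move=> h; apply/eqmodP/asboolP.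
Qed.

Lemma mkgermP (a : stalk) : exists U (Ux : oset U x) s, a = mkgerm Ux s.
Proof.
exists (pg_open (repr a)), (pg_mem (repr a)), (pg_sec (repr a)).
by rewrite /mkgerm; case: (repr a) (reprK a).
Qed.

Lemma mkgerm_res (U V : opens X) (h : V `<=` U) (Ux : oset U x)
  (Vx : oset V x) s : mkgerm Vx (res h s) = mkgerm Ux s.
Proof.
apply/mkgerm_eq; exists V, (@subset_refl _ _), h; split => //.
by rewrite res_id.
Qed.

Lemma mkgerm2P (a b : stalk) :
  exists U (Ux : oset U x) s t, a = mkgerm Ux s /\ b = mkgerm Ux t.
Proof.
have [U [Ux [s ->]]] := mkgermP a; have [V [Vx [t ->]]] := mkgermP b.
exists (openI U V), (openI_mem Ux Vx), (res (@openIl _ _ U V) s),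
  (res (@openIr _ _ U V) t).
by rewrite !(mkgerm_res _ _ (openI_mem Ux Vx)).
Qed.

Definition stalk_add (a b : stalk) : stalk :=
  let U := pg_open (repr a) in let V := pg_open (repr b) in
  mkgerm (openI_mem (pg_mem (repr a)) (pg_mem (repr b)))
    (res (@openIl _ _ U V) (pg_sec (repr a))
     + res (@openIr _ _ U V) (pg_sec (repr b))).

Lemma mkgermD (U : opens X) (Ux : oset U x) (s t : F U) :
  stalk_add (mkgerm Ux s) (mkgerm Ux t) = mkgerm Ux (s + t).
Proof.
rewrite /stalk_add.
have : mkgerm (pg_mem (repr (mkgerm Ux s))) (pg_sec (repr (mkgerm Ux s)))
   = mkgerm Ux s by rewrite -[RHS]reprK /mkgerm; case: (repr _).
have : mkgerm (pg_mem (repr (mkgerm Ux t))) (pg_sec (repr (mkgerm Ux t)))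
   = mkgerm Ux t by rewrite -[RHS]reprK /mkgerm; case: (repr _).
case: (repr (mkgerm Ux s)) => A Ax a; case: (repr (mkgerm Ux t)) => B Bx b /=.
move=> /mkgerm_eq[V [VB [VU [Vx eb]]]] /mkgerm_eq[W [WA [WU [Wx ea]]]].
apply/mkgerm_eq; pose Z := openI V W.
have ZV : Z `<=` V := @openIl _ _ V W; have ZW : Z `<=` W := @openIr _ _ V W.
have ZAB : Z `<=` openI A B by move=> y [/VB ? /WA].
have ZU := subset_trans ZV VU.
exists Z, ZAB, ZU; split => //.
rewrite !resD.
rewrite (res_comp _ _ (subset_trans ZW WA)) (res_comp _ _ (subset_trans ZV VB)).
rewrite -(res_comp WA ZW) -(res_comp VB ZV) ea eb.
by rewrite (res_comp WU ZW ZU) (res_comp VU ZV ZU).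
Qed.
End Stalk.

Section StalkZmod.
Variables (R : realType) (X : rspace R) (F : omod X) (x : X).
Implicit Types a b c : stalk F x.

Definition stalk_zero : stalk F x := @mkgerm _ _ F x (openT X) I 0.
Definition stalk_opp a : stalk F x :=
  mkgerm (pg_mem (repr a)) (- pg_sec (repr a)).

Lemma res0 (U V : opens X) (h : V `<=` U) : res h (0 : F U) = 0.
Proof. by apply: (addrI (res h 0)); rewrite -resD !addr0. Qed.
Lemma resN (U V : opens X) (h : V `<=` U) (s : F U) : res h (- s) = - res h s.
Proof. by apply: (addrI (res h s)); rewrite -resD !subrr res0. Qed.

Lemma mkgerm0 (U : opens X) (Ux : oset U x) :
  mkgerm Ux (0 : F U) = stalk_zero.
Proof.
apply/mkgerm_eq; exists U, (@subset_refl _ _), (fun=> fun=> I).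
by rewrite !res0.
Qed.
Lemma repr_mkgerm a : mkgerm (pg_mem (repr a)) (pg_sec (repr a)) = a.
Proof. by rewrite -[RHS]reprK /mkgerm; case: (repr _). Qed.
Lemma mkgermN (U : opens X) (Ux : oset U x) (s : F U) :
  stalk_opp (mkgerm Ux s) = mkgerm Ux (- s).
Proof.
rewrite /stalk_opp; have := repr_mkgerm (mkgerm Ux s).
case: (repr _) => A Ax a /= /mkgerm_eq[W [WA [WU [Wx e]]]].
by apply/mkgerm_eq; exists W, WA, WU; rewrite !resN e.
Qed.

Fact stalk_addA : associative (@stalk_add _ _ F x).
Proof.
move=> a b c; have [U [Ux [s [t [-> ->]]]]] := mkgerm2P a b.
have [V [Vx [r ->]]] := mkgermP c.
rewrite -!(mkgerm_res (@openIl _ _ U V) _ (openI_mem Ux Vx)).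
rewrite -(mkgerm_res (@openIr _ _ U V) _ (openI_mem Ux Vx)).
by rewrite !mkgermD addrA.
Qed.
Fact stalk_addC : commutative (@stalk_add _ _ F x).
Proof.
by move=> a b; have [U [Ux [s [t [-> ->]]]]] := mkgerm2P a b; rewrite !mkgermD addrC.
Qed.
Fact stalk_add0 : left_id stalk_zero (@stalk_add _ _ F x).
Proof.
by move=> a; have [U [Ux [s ->]]] := mkgermP a; rewrite -(mkgerm0 Ux) mkgermD add0r.
Qed.
Fact stalk_addN : left_inverse stalk_zero stalk_opp (@stalk_add _ _ F x).
Proof.
move=> a; have [U [Ux [s ->]]] := mkgermP a.
by rewrite mkgermN mkgermD addNr mkgerm0.
Qed.
HB.instance Definition _ := GRing.isZmodule.Build (stalk F x)
  stalk_addA stalk_addC stalk_add0 stalk_addN.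

Definition stalk_scale (a : stalk (struct_sheaf X) x) (b : stalk F x) :
  stalk F x :=
  let U := pg_open (repr a) in let V := pg_open (repr b) in
  mkgerm (openI_mem (pg_mem (repr a)) (pg_mem (repr b)))
    (rrestr (@openIl _ _ U V) (pg_sec (repr a))
     *: res (@openIr _ _ U V) (pg_sec (repr b))).

Lemma mkgermZ (U : opens X) (Ux : oset U x) (f : regfun U) (s : F U) :
  stalk_scale (@mkgerm _ _ (struct_sheaf X) x U Ux f) (mkgerm Ux s)
  = mkgerm Ux (f *: s).
Proof.
rewrite /stalk_scale.
set fx := mkgerm Ux (f : struct_sheaf X U).
have : mkgerm (pg_mem (repr fx)) (pg_sec (repr fx)) = fx.
  by rewrite -[RHS]reprK /mkgerm; case: (repr _).
have := repr_mkgerm (mkgerm Ux s); rewrite /fx {fx}.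
case: (repr (mkgerm Ux s)) => B Bx b.
case: (repr (mkgerm Ux (f : struct_sheaf X U))) => A Ax a /=.
move=> /mkgerm_eq[V [VB [VU [Vx eb]]]] /mkgerm_eq[W [WA [WU [Wx ea]]]].
apply/mkgerm_eq; pose Z := openI V W.
have ZV : Z `<=` V := @openIl _ _ V W; have ZW : Z `<=` W := @openIr _ _ V W.
have ZAB : Z `<=` openI A B by move=> y [/VB ? /WA].
have ZU := subset_trans ZV VU.
exists Z, ZAB, ZU; split => //.
rewrite !resZ (rrestr_comp _ _ (subset_trans ZW WA)).
rewrite (res_comp _ _ (subset_trans ZV VB)).
rewrite -(rrestr_comp WA ZW) -(res_comp VB ZV) eb; move: ea => /= ->.
by rewrite (rrestr_comp WU ZW ZU) (res_comp VU ZV ZU).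
Qed.

End StalkZmod.

Definition local_ring (R : realType) (X : rspace R) (x : X) : Type :=
  stalk (struct_sheaf X) x.
HB.instance Definition _ R X x := GRing.Zmodule.on (@local_ring R X x).

Section StalkLmod.
Variables (R : realType) (X : rspace R) (x : X).

Definition rgerm (U : opens X) (Ux : oset U x) (f : regfun U) : local_ring x :=
  @mkgerm _ _ (struct_sheaf X) x U Ux f.

Lemma rgerm_res (U V : opens X) (h : V `<=` U) (Ux : oset U x)
  (Vx : oset V x) f : rgerm Vx (rrestr h f) = rgerm Ux f.
Proof. exact: (@mkgerm_res _ _ (struct_sheaf X)). Qed.
Lemma rgermP (a : local_ring x) : exists U (Ux : oset U x) f, a = rgerm Ux f.
Proof.
by have [U [Ux [f e]]] := @mkgermP _ _ (struct_sheaf X) x a; exists U, Ux, f.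
Qed.
Lemma rgermD (U : opens X) (Ux : oset U x) (f g : regfun U) :
  rgerm Ux f + rgerm Ux g = rgerm Ux (f + g).
Proof. exact: (@mkgermD _ _ (struct_sheaf X)). Qed.

Definition local_mul (a b : local_ring x) : local_ring x := stalk_scale a b.

Lemma rgermM (U : opens X) (Ux : oset U x) (f g : regfun U) :
  local_mul (rgerm Ux f) (rgerm Ux g) = rgerm Ux (f * g).
Proof. exact: mkgermZ. Qed.

Section Scale.
Variable F : omod X.
Implicit Types (a b : local_ring x) (s t : stalk F x).

Lemma mkgermDE (U : opens X) (Ux : oset U x) (s t : F U) :
  mkgerm Ux s + mkgerm Ux t = mkgerm Ux (s + t).
Proof. exact: mkgermD. Qed.
Lemma mkgermZE (U : opens X) (Ux : oset U x) (f : regfun U) (s : F U) :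
  stalk_scale (rgerm Ux f) (mkgerm Ux s) = mkgerm Ux (f *: s).
Proof. exact: mkgermZ. Qed.

Lemma rgerm_sP a s : exists U (Ux : oset U x) f r,
  a = rgerm Ux f /\ s = mkgerm Ux r.
Proof.
have [U [Ux [f ->]]] := rgermP a; have [V [Vx [t ->]]] := mkgermP s.
exists (openI U V), (openI_mem Ux Vx), (rrestr (@openIl _ _ U V) f),
  (res (@openIr _ _ U V) t).
by rewrite (rgerm_res _ Ux) (mkgerm_res _ Vx).
Qed.
Lemma rgerm2_sP a b s : exists U (Ux : oset U x) f g r,
  [/\ a = rgerm Ux f, b = rgerm Ux g & s = mkgerm Ux r].
Proof.
have [U [Ux [f ->]]] := rgermP a; have [V [Vx [g [t [-> ->]]]]] := rgerm_sP b s.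
exists (openI U V), (openI_mem Ux Vx), (rrestr (@openIl _ _ U V) f),
  (rrestr (@openIr _ _ U V) g), (res (@openIr _ _ U V) t).
by rewrite (rgerm_res _ Ux) (rgerm_res _ Vx) (mkgerm_res _ Vx).
Qed.

Fact stalk_scaleA a b s :
  stalk_scale a (stalk_scale b s) = stalk_scale (local_mul a b) s.
Proof.
have [U [Ux [f [g [r [-> -> ->]]]]]] := rgerm2_sP a b s.
by rewrite rgermM !mkgermZE scalerA.
Qed.
Fact stalk_scaleDr a s t :
  stalk_scale a (s + t) = stalk_scale a s + stalk_scale a t.
Proof.
have [V [Vx [f ->]]] := rgermP a.
have [U [Ux [r [q [-> ->]]]]] := mkgerm2P s t.
rewrite -(rgerm_res (@openIl _ _ V U) _ (openI_mem Vx Ux)).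
rewrite -!(mkgerm_res (@openIr _ _ V U) _ (openI_mem Vx Ux)).
by rewrite !(mkgermDE, mkgermZE) scalerDr.
Qed.
Fact stalk_scaleDl s a b :
  stalk_scale (a + b) s = stalk_scale a s + stalk_scale b s.
Proof.
have [U [Ux [f [g [r [-> -> ->]]]]]] := rgerm2_sP a b s.
by rewrite rgermD !mkgermZE mkgermDE scalerDl.
Qed.
Fact stalk_scale1 : left_id (@rgerm (openT X) I 1 : local_ring x) (@stalk_scale _ _ F x).
Proof.
move=> s; have [U [Ux [r ->]]] := mkgermP s.
have h : U `<=` openT X by [].
by rewrite -(rgerm_res h I Ux) rrestr1 mkgermZE scale1r.
Qed.
End Scale.

Fact local_mulC : commutative local_mul.
Proof.
move=> a b; have [U [Ux [f [g [-> ->]]]]] := rgerm_sP a (b : stalk (struct_sheaf X) x).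
by rewrite (rgermM Ux f g) (rgermM Ux g f) mulrC.
Qed.
HB.instance Definition _ := GRing.Zmodule_isComPzRing.Build (local_ring x)
  (@stalk_scaleA (struct_sheaf X)) local_mulC (@stalk_scale1 (struct_sheaf X))
  (fun a b c => @stalk_scaleDl (struct_sheaf X) c a b).

HB.instance Definition _ (F : omod X) :=
  GRing.Zmodule_isLmodule.Build (local_ring x) (stalk F x)
  (@stalk_scaleA F) (@stalk_scale1 F) (@stalk_scaleDr F) (@stalk_scaleDl F).

End StalkLmod.

(* The germ at x of a section over U; it is 0 by convention if x is not in U. *)
Definition germ (R : realType) (X : rspace R) (F : omod X) (x : X)
  (U : opens X) (s : F U) : stalk F x :=
  if pselect (oset U x) is left Ux then mkgerm Ux s else 0.

Definition fgerm (R : realType) (X : rspace R) (x : X)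
  (U : opens X) (f : regfun U) : local_ring x :=
  @germ R X (struct_sheaf X) x U f.

Lemma germE R (X : rspace R) (F : omod X) x (U : opens X) (Ux : oset U x)
  (s : F U) : germ x s = mkgerm Ux s.
Proof.
rewrite /germ; case: pselect => // Ux'; congr mkgerm; exact: Prop_irrelevance.
Qed.

Section GermTheory.
Variables (R : realType) (X : rspace R) (F : omod X) (x : X).
Implicit Types U V : opens X.

Lemma germ_res U V (h : V `<=` U) (s : F U) :
  oset V x -> germ x (res h s) = germ x s.
Proof. by move=> Vx; rewrite (germE Vx) (germE (h _ Vx)); exact: mkgerm_res. Qed.
Lemma germD U (s t : F U) : germ x (s + t) = germ x s + germ x t.
Proof.
by rewrite /germ; case: pselect => Ux; rewrite ?mkgermDE ?addr0.
Qed.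
Lemma germ0 U : germ x (0 : F U) = 0.
Proof. by apply: (addrI (germ x (0 : F U))); rewrite -germD !addr0. Qed.
Lemma germN U (s : F U) : germ x (- s) = - germ x s.
Proof. by apply: (addrI (germ x s)); rewrite -germD !subrr germ0. Qed.
Lemma germ_eqP U (s t : F U) : oset U x -> germ x s = germ x t <->
  exists (W : opens X) (h : W `<=` U), oset W x /\ res h s = res h t.
Proof.
move=> Ux; rewrite !(germE Ux) mkgerm_eq; split.
- by move=> [W [h [h' [Wx e]]]]; exists W, h; rewrite [in RHS](Prop_irrelevance h h').
- by move=> [W [h [Wx e]]]; exists W, h, h.
Qed.
Lemma germ_struct U (f : regfun U) :
  @germ _ _ (struct_sheaf X) x U f = fgerm x f.
Proof. by []. Qed.
Lemma fgermD U (f g : regfun U) : fgerm x (f + g) = fgerm x f + fgerm x g.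
Proof.
rewrite /fgerm /germ; case: pselect => Ux; last by rewrite addr0.
by rewrite -[LHS](rgermD Ux).
Qed.
Lemma fgermN U (f : regfun U) : fgerm x (- f) = - fgerm x f.
Proof.
have f0 : fgerm x (0 : regfun U) = 0.
  by apply: (addrI (fgerm x (0 : regfun U))); rewrite -[LHS]fgermD !addr0.
by apply/eqP; rewrite -subr_eq0 opprK -fgermD addNr f0.
Qed.
Lemma fgermM U (f g : regfun U) : fgerm x (f * g) = fgerm x f * fgerm x g.
Proof.
rewrite /fgerm /germ; case: pselect => Ux; last by rewrite mulr0.
by rewrite -[LHS](rgermM Ux).
Qed.
Lemma fgerm1 U : oset U x -> fgerm x (1 : regfun U) = 1.
Proof.
move=> Ux; rewrite /fgerm (germE (F := struct_sheaf X) Ux).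
have h : U `<=` openT X by [].
by rewrite -[LHS]/(rgerm Ux 1) -(rrestr1 h) (rgerm_res h I).
Qed.
End GermTheory.

Lemma fgerm_res (R : realType) (X : rspace R) (x : X) (U V : opens X) (h : V `<=` U) (f : regfun U) :
  oset V x -> fgerm x (rrestr h f) = fgerm x f.
Proof. exact: (@germ_res R X (struct_sheaf X) x U V h f). Qed.

Definition globally_generated (R : realType) (X : rspace R) (F : omod X) :=
  forall (x : X) (t : stalk F x),
  exists (m : nat) (a : 'I_m -> local_ring x) (s : 'I_m -> F (openT X)),
    t = \sum_(i < m) a i *: germ x (s i).

(* Extension of scalars M (x)_A B along phi : A -> B: formal sums of pure     *)
(* tensors modulo the congruence generated by the usual relations.            *)
Section BaseChange.
Variables (A B : comPzRingType) (phi : {rmorphism A -> B}) (M : lmodType A).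

Inductive tens_eq : seq (M * B) -> seq (M * B) -> Prop :=
| tens_refl s : tens_eq s s
| tens_sym s t : tens_eq s t -> tens_eq t s
| tens_trans s t u : tens_eq s t -> tens_eq t u -> tens_eq s u
| tens_cat s s' t t' :
    tens_eq s s' -> tens_eq t t' -> tens_eq (s ++ t) (s' ++ t')
| tens_catC s t : tens_eq (s ++ t) (t ++ s)
| tens_0 b : tens_eq [:: (0, b)] [::]
| tens_Dl m m' b : tens_eq [:: (m + m', b)] [:: (m, b); (m', b)]
| tens_Dr m b b' : tens_eq [:: (m, b + b')] [:: (m, b); (m, b')]
| tens_Z a m b : tens_eq [:: (a *: m, b)] [:: (m, phi a * b)].

Definition tens_rel : rel (seq (M * B)) := fun s t => `[< tens_eq s t >].

Fact tens_equiv : equiv_class_of tens_rel.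
Proof.
split=> [s | s t | t s u].
- by apply/asboolP; exact: tens_refl.
- by apply/asboolP/asboolP; exact: tens_sym.
- by move=> /asboolP h /asboolP h'; apply/asboolP; exact: tens_trans h h'.
Qed.
Canonical tens_equiv_rel := EquivRelPack tens_equiv.

Definition base_change := {eq_quot tens_rel}.
HB.instance Definition _ := Choice.on base_change.

Definition tens (m : M) (b : B) : base_change := \pi_base_change [:: (m, b)].

Let bc_pi s : base_change := \pi_base_change s.

Local Lemma bc_eq s t : tens_eq s t -> bc_pi s = bc_pi t.
Proof. move=> h; by apply/(@eqmodP _ tens_equiv_rel s t)/asboolP. Qed.
Local Lemma bc_repr s : tens_eq (repr (bc_pi s)) s.
Proof. by apply/asboolP/(@eqmodP _ tens_equiv_rel); exact: reprK. Qed.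
Local Lemma bcP (x : base_change) : exists s, x = bc_pi s.
Proof. by exists (repr x); rewrite /bc_pi reprK. Qed.

Let negf (mb : M * B) := (- mb.1, mb.2).
Let mulf (c : B) (mb : M * B) := (mb.1, c * mb.2).

Local Lemma tens_negl m b : tens_eq [:: (m, b); (- m, b)] [::].
Proof.
apply: tens_trans (tens_sym (tens_Dl _ _ _)) _.
by rewrite subrr; exact: tens_0.
Qed.
Local Lemma tens_r0 m : tens_eq [:: (m, 0)] [::].
Proof.
have := tens_Z 0 m 0; rewrite scale0r mulr0 => h.
exact: tens_trans (tens_sym h) (tens_0 _).
Qed.
Local Lemma tens_map_neg s t : tens_eq s t -> tens_eq (map negf s) (map negf t).
Proof.
elim=> {s t}.
- by move=> s; exact: tens_refl.
- by move=> s t _; exact: tens_sym.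
- by move=> s t u _ h _ h'; exact: tens_trans h h'.
- by move=> s s' t t' _ h _ h'; rewrite !map_cat; exact: tens_cat.
- by move=> s t; rewrite !map_cat; exact: tens_catC.
- by move=> b; rewrite /= /negf /= oppr0; exact: tens_0.
- by move=> m m' b; rewrite /= /negf /= opprD; exact: tens_Dl.
- by move=> m b b'; exact: tens_Dr.
- by move=> a m b; rewrite /= /negf /= -scalerN; exact: tens_Z.
Qed.
Local Lemma tens_map_mul c s t :
  tens_eq s t -> tens_eq (map (mulf c) s) (map (mulf c) t).
Proof.
elim=> {s t}.
- by move=> s; exact: tens_refl.
- by move=> s t _; exact: tens_sym.
- by move=> s t u _ h _ h'; exact: tens_trans h h'.
- by move=> s s' t t' _ h _ h'; rewrite !map_cat; exact: tens_cat.
- by move=> s t; rewrite !map_cat; exact: tens_catC.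
- by move=> b; exact: tens_0.
- by move=> m m' b; exact: tens_Dl.
- by move=> m b b'; rewrite /= /mulf /= mulrDr; exact: tens_Dr.
- by move=> a m b; rewrite /= /mulf /= mulrCA; exact: tens_Z.
Qed.

Definition bc_add (x y : base_change) : base_change :=
  \pi_base_change (repr x ++ repr y).
Definition bc_zero : base_change := \pi_base_change [::].
Definition bc_opp (x : base_change) : base_change :=
  \pi_base_change [seq (- mb.1, mb.2) | mb <- repr x].
Definition bc_scale (c : B) (x : base_change) : base_change :=
  \pi_base_change [seq (mb.1, c * mb.2) | mb <- repr x].

Local Lemma bc_piD s t : bc_add (bc_pi s) (bc_pi t) = bc_pi (s ++ t).
Proof. by apply: bc_eq; apply: tens_cat; exact: bc_repr. Qed.
Local Lemma bc_piN s : bc_opp (bc_pi s) = bc_pi (map negf s).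
Proof. by apply: bc_eq; apply: tens_map_neg; exact: bc_repr. Qed.
Local Lemma bc_piZ c s : bc_scale c (bc_pi s) = bc_pi (map (mulf c) s).
Proof. by apply: bc_eq; apply: tens_map_mul; exact: bc_repr. Qed.

Fact bc_addA : associative bc_add.
Proof.
move=> x y z; case: (bcP x) (bcP y) (bcP z) => s -> [t ->] [u ->].
by rewrite !bc_piD catA.
Qed.
Fact bc_addC : commutative bc_add.
Proof.
move=> x y; case: (bcP x) (bcP y) => s -> [t ->].
by rewrite !bc_piD; apply: bc_eq; exact: tens_catC.
Qed.
Fact bc_add0 : left_id bc_zero bc_add.
Proof. by move=> x; case: (bcP x) => s ->; rewrite [bc_zero]/(bc_pi [::]) bc_piD. Qed.
Fact bc_addN : left_inverse bc_zero bc_opp bc_add.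
Proof.
move=> x; case: (bcP x) => s ->; rewrite bc_piN bc_piD; apply: bc_eq.
elim: s => [|[m b] s IH]; first exact: tens_refl.
have h : tens_eq [:: negf (m, b); (m, b)] [::].
  exact: tens_trans (tens_catC [:: negf (m, b)] [:: (m, b)]) (tens_negl m b).
have h1 := tens_cat (tens_refl [:: negf (m, b)])
  (tens_catC (map negf s) ((m, b) :: s)).
have h2 := tens_cat h (tens_trans (tens_catC s (map negf s)) IH).
exact: tens_trans h1 h2.
Qed.
HB.instance Definition _ := GRing.isZmodule.Build base_change
  bc_addA bc_addC bc_add0 bc_addN.

Fact bc_scaleA c d x : bc_scale c (bc_scale d x) = bc_scale (c * d) x.
Proof.
case: (bcP x) => s ->; rewrite !bc_piZ -map_comp; congr bc_pi.
by apply: eq_map => -[m b]; rewrite /= /mulf /= mulrA.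
Qed.
Fact bc_scale1 : left_id 1 bc_scale.
Proof.
move=> x; case: (bcP x) => s ->; rewrite bc_piZ -[in RHS](map_id s); congr bc_pi.
by apply: eq_map => -[m b]; rewrite /mulf /= mul1r.
Qed.
Fact bc_scaleDr : right_distributive bc_scale +%R.
Proof.
move=> c x y; case: (bcP x) (bcP y) => s -> [t ->].
by rewrite [bc_pi s + bc_pi t]bc_piD !bc_piZ [RHS]bc_piD map_cat.
Qed.
Fact bc_scaleDl x : {morph bc_scale^~ x : c d / c + d}.
Proof.
move=> c d; case: (bcP x) => s ->; rewrite !bc_piZ [RHS]bc_piD; apply: bc_eq.
elim: s => [|[m b] s IH]; first exact: tens_refl.
have h : tens_eq (map (mulf (c + d)) ((m, b) :: s))
    ([:: mulf c (m, b); mulf d (m, b)] ++ (map (mulf c) s ++ map (mulf d) s)).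
  rewrite map_cons -cat1s; apply: tens_cat IH.
  by rewrite /mulf /= mulrDl; exact: tens_Dr.
apply: tens_trans h _; rewrite !map_cons.
move: (mulf c (m, b)) (mulf d (m, b)) (map (mulf c) s) (map (mulf d) s) => u v C D.
have h := tens_cat (tens_cat (tens_refl [:: u]) (tens_catC [:: v] C)) (tens_refl D).
have e : ([:: u] ++ (C ++ [:: v])) ++ D = (u :: C) ++ (v :: D) by rewrite /= -catA.
by rewrite -e.
Qed.
HB.instance Definition _ := GRing.Zmodule_isLmodule.Build B base_change
  bc_scaleA bc_scale1 bc_scaleDr bc_scaleDl.

Lemma tensDl m m' b : tens (m + m') b = tens m b + tens m' b.
Proof. by rewrite [RHS]bc_piD; apply: bc_eq; exact: tens_Dl. Qed.
Lemma tensDr m b b' : tens m (b + b') = tens m b + tens m b'.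
Proof. by rewrite [RHS]bc_piD; apply: bc_eq; exact: tens_Dr. Qed.
Lemma tensZl a m b : tens (a *: m) b = tens m (phi a * b).
Proof. by apply: bc_eq; exact: tens_Z. Qed.
Lemma tensZr c m b : c *: tens m b = tens m (c * b).
Proof. exact: bc_piZ. Qed.
Lemma tensNl m b : tens (- m) b = - tens m b.
Proof. by rewrite [RHS]bc_piN. Qed.

End BaseChange.

(* Regular maps: continuous maps that pull back regular functions to regular   *)
(* functions.                                                                 *)
Record rmap (R : realType) (X Y : rspace R) := RMap {
  rmap_fun :> X -> Y;
  rmap_open : forall V, zopen V -> zopen (rmap_fun @^-1` V);
  rmap_regular : forall V g, zopen V -> zregular V g ->
    zregular (rmap_fun @^-1` V) (g \o rmap_fun) }.

Section Maps.
Variable R : realType.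

Definition rmap_id (X : rspace R) : rmap X X :=
  @RMap R X X id (fun V oV => oV) (fun V g oV rg => rg).

Definition rmap_comp (X Y Z : rspace R) (g : rmap Y Z) (f : rmap X Y) :
    rmap X Z :=
  @RMap R X Z (g \o f) (fun V oV => rmap_open f (rmap_open g oV))
    (fun V h oV rh => rmap_regular f (rmap_open g oV) (rmap_regular g oV rh)).

Definition rmap_iso (X Y : rspace R) (f : rmap X Y) :=
  exists g : rmap Y X, cancel f g /\ cancel g f.

Variables (X Y : rspace R) (f : rmap X Y).

Definition preopen (V : opens Y) : opens X := Opens (rmap_open f (opensP V)).

Definition regfun_pull (V : opens Y) (g : regfun V) : regfun (preopen V) :=
  @mkregfun _ _ (preopen V) (g \o f) (rmap_regular f (opensP V) (regfun_reg g)).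

Lemma regfun_pullE (V : opens Y) (g : regfun V) y :
  oset V (f y) -> regfun_pull g y = g (f y).
Proof. by move=> Vy; rewrite mkregfunE. Qed.

Variable x : X.

Definition local_pull (a : local_ring (f x)) : local_ring x :=
  @rgerm _ _ x (preopen (pg_open (repr a))) (pg_mem (repr a))
    (regfun_pull (pg_sec (repr a))).

Lemma local_pullE (V : opens Y) (Vx : oset V (f x)) (g : regfun V) :
  local_pull (rgerm Vx g) = @rgerm _ _ x (preopen V) Vx (regfun_pull g).
Proof.
rewrite /local_pull.
have : mkgerm (pg_mem (repr (rgerm Vx g))) (pg_sec (repr (rgerm Vx g)))
   = rgerm Vx g by exact: repr_mkgerm.
case: (repr _) => A Ax a /= /mkgerm_eq[W [WA [WV [Wx e]]]].
apply/mkgerm_eq.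
have WA' : preopen W `<=` preopen A by move=> y /WA.
have WV' : preopen W `<=` preopen V by move=> y /WV.
exists (preopen W), WA', WV'; split => //; apply: regfun_eqP => y Wy.
rewrite !rrestrE // !mkregfunE /=; [|exact: (WV _ Wy)|exact: (WA _ Wy)].
have e' : rrestr WA a = rrestr WV g := e.
by have := congr1 (fun k : regfun W => k (f y)) e'; rewrite !rrestrE.
Qed.

Fact local_pull_zmod : zmod_morphism local_pull.
Proof.
move=> a b.
have [U [Ux [g [h [-> ->]]]]] := rgerm_sP a (b : stalk (struct_sheaf Y) (f x)).
have rB (Z : rspace R) z (W : opens Z) (Wz : oset W z) (u v : regfun W) :
    rgerm Wz u - rgerm Wz v = rgerm Wz (u - v).
  by apply/eqP; rewrite subr_eq rgermD subrK.
rewrite [X in local_pull X](rB _ _ _ Ux g h) !local_pullE rB; congr rgerm.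
apply: regfun_eqP => y Uy.
by rewrite regfun_pullE // !regfunB_val !regfun_pullE.
Qed.
Fact local_pull_monoid : monoid_morphism local_pull.
Proof.
split.
  have -> : 1 = @rgerm _ _ (f x) (openT Y) I 1 by [].
  rewrite local_pullE.
  have -> : 1 = @rgerm _ _ x (openT X) I 1 by [].
  apply/mkgerm_eq; exists (openT X), (fun=> id), (fun=> id); split => //.
  apply: regfun_eqP => y _.
  by rewrite [LHS]rrestrE // [RHS]rrestrE // regfun_pullE // !regfun_oneE.
move=> a b.
have [U [Ux [g [h [-> ->]]]]] := rgerm_sP a (b : stalk (struct_sheaf Y) (f x)).
rewrite [X in local_pull X](rgermM Ux g h) !local_pullE [RHS]rgermM.
congr rgerm; apply: regfun_eqP => y Uy.
by rewrite regfun_pullE // !regfun_mulE !regfun_pullE.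
Qed.
HB.instance Definition _ := GRing.isZmodMorphism.Build
  (local_ring (f x)) (local_ring x) local_pull local_pull_zmod.
HB.instance Definition _ := GRing.isMonoidMorphism.Build
  (local_ring (f x)) (local_ring x) local_pull local_pull_monoid.

End Maps.
Arguments local_pull {R X Y} f x a.

Definition zprod (I : Type) (M : I -> zmodType) := forall i, M i.
HB.instance Definition _ I (M : I -> zmodType) := Choice.on (@zprod I M).
Section Zprod.
Variables (I : Type) (M : I -> zmodType).
Implicit Types s t : zprod M.
Definition zprod0 : zprod M := fun=> 0.
Definition zprodN s : zprod M := fun i => - s i.
Definition zprodD s t : zprod M := fun i => s i + t i.
Fact zprodA : associative zprodD.
Proof. by move=> s t u; apply: functional_extensionality_dep => i; exact: addrA. Qed.
Fact zprodC : commutative zprodD.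
Proof. by move=> s t; apply: functional_extensionality_dep => i; exact: addrC. Qed.
Fact zprod0D : left_id zprod0 zprodD.
Proof. by move=> s; apply: functional_extensionality_dep => i; exact: add0r. Qed.
Fact zprodND : left_inverse zprod0 zprodN zprodD.
Proof. by move=> s; apply: functional_extensionality_dep => i; exact: addNr. Qed.
HB.instance Definition _ := GRing.isZmodule.Build (zprod M)
  zprodA zprodC zprod0D zprodND.
End Zprod.

Section Pullback.
Variables (R : realType) (X Y : rspace R) (f : rmap X Y) (F : omod Y).

Definition pullback_stalk (x : X) : lmodType (local_ring x) :=
  base_change (local_pull f x) (stalk F (f x)).

(* The sheaf associated with the presheaf tensor product of f^-1 F with O_X   *)
(* over f^-1 O_Y: families of elements of the stalks that are locally given   *)
(* by one finite sum of tensors of sections.                                  *)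
Definition pullback_local (U : opens X) (t : zprod pullback_stalk) :=
  forall x, oset U x ->
  exists (V : opens X) (W : opens Y) (m : nat)
         (s : 'I_m -> F W) (g : 'I_m -> regfun V),
  [/\ V `<=` U, oset V x, V `<=` f @^-1` W &
    forall y, oset V y ->
      t y = \sum_(i < m) tens (local_pull f y) (germ (f y) (s i)) (fgerm y (g i))].

Definition pullback_pred (U : opens X) : {pred zprod pullback_stalk} :=
  [pred t | `[< pullback_local U t /\ forall x, ~ oset U x -> t x = 0 >]].

Record pullback_sec (U : opens X) := PullbackSec {
  pullback_fun : zprod pullback_stalk;
  pullbackP : pullback_fun \in pullback_pred U }.

End Pullback.
Arguments pullback_local {R X Y} f F U t.
Arguments pullback_pred {R X Y} f F U.

HB.instance Definition _ R (X Y : rspace R) (f : rmap X Y) (F : omod Y)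
  (U : opens X) := [isSub for @pullback_fun R X Y f F U].
HB.instance Definition _ R (X Y : rspace R) (f : rmap X Y) (F : omod Y)
  (U : opens X) := [Choice of @pullback_sec R X Y f F U by <:].

Section PullbackTheory.
Variables (R : realType) (X Y : rspace R) (f : rmap X Y) (F : omod Y).
Implicit Types U V : opens X.
Local Notation psec := (pullback_sec f F).

Lemma pullback_localB U s t : pullback_local f F U s -> pullback_local f F U t ->
  pullback_local f F U (fun x => s x - t x).
Proof.
move=> hs ht x Ux.
have [V [W [m [u [g [VU Vx VW e]]]]]] := hs x Ux.
have [V' [W' [m' [u' [g' [V'U V'x V'W' e']]]]]] := ht x Ux.
pose V2 := openI V V'; pose W2 := openI W W'.
exists V2, W2, (m + m')%N,
  (fun i : 'I_(m + m') => match fintype.split i with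
     | inl j => res (@openIl _ _ W W') (u j)
     | inr j => - res (@openIr _ _ W W') (u' j) end),
  (fun i : 'I_(m + m') => match fintype.split i with
     | inl j => rrestr (@openIl _ _ V V') (g j)
     | inr j => rrestr (@openIr _ _ V V') (g' j) end); split => //.
- by move=> y [/VU].
- by move=> y [/VW ? /V'W'].
move=> y [Vy V'y]; have Wy := VW _ Vy; have W'y := V'W' _ V'y.
rewrite e // e' // big_split_ord /= -sumrN; congr (_ + _); apply: eq_bigr => i _.
  have -> : fintype.split (lshift m' i) = inl i by exact: (unsplitK (inl i)).
  by rewrite germ_res // fgerm_res.
have -> : fintype.split (rshift m i) = inr i by exact: (unsplitK (inr i)).
by rewrite germN germ_res // fgerm_res // tensNl.
Qed.

Lemma pullback_localZ U (a : regfun U) s : pullback_local f F U s ->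
  pullback_local f F U (fun x => fgerm x a *: s x).
Proof.
move=> hs x Ux; have [V [W [m [u [g [VU Vx VW e]]]]]] := hs x Ux.
exists V, W, m, u, (fun i => rrestr VU a * g i); split => // y Vy.
rewrite e // scaler_sumr; apply: eq_bigr => i _.
by rewrite tensZr fgermM fgerm_res.
Qed.

Lemma pullback_local_res U V s : V `<=` U -> pullback_local f F U s ->
  pullback_local f F V s.
Proof.
move=> VU hs x Vx; have [W [Z [m [u [g [WU Wx WZ e]]]]]] := hs x (VU _ Vx).
exists (openI W V), Z, m, u, (fun i => rrestr (@openIl _ _ W V) (g i)).
split => //; [by move=> y [] | by move=> y [/WZ] |].
move=> y [Wy Vy]; rewrite e //; apply: eq_bigr => i _.
by rewrite fgerm_res.
Qed.

Lemma pullback_local_glue U s :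
  (forall x, oset U x -> exists V t, [/\ oset V x, V `<=` U,
    pullback_local f F V t & forall y, oset V y -> s y = t y]) ->
  pullback_local f F U s.
Proof.
move=> h x /h[V [t [Vx VU ht e]]].
have [W [Z [m [u [g [WV Wx WZ e']]]]]] := ht x Vx.
exists W, Z, m, u, g; split => //; first exact: subset_trans WV VU.
by move=> y Wy; rewrite e ?e' //; exact: WV.
Qed.

Fact pullback_zmod_closed U : zmod_closed (pullback_pred f F U).
Proof.
split.
  apply/asboolP; split => // x Ux.
  exists U, (openT Y), 0%N, (fun=> 0), (fun=> 0); split => // y _.
  by rewrite big_ord0.
move=> s t /asboolP[hs s0] /asboolP[ht t0]; apply/asboolP; split.
  exact: pullback_localB.
move=> x Ux; have -> : (s - t) x = s x - t x by [].
by rewrite s0 // t0 // subr0.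
Qed.
HB.instance Definition _ U := GRing.isZmodClosed.Build
  (zprod (pullback_stalk f F)) (pullback_pred f F U) (pullback_zmod_closed U).
HB.instance Definition _ U := [SubChoice_isSubZmodule of psec U by <:].

Lemma pullback_loc U (s : psec U) : pullback_local f F U (pullback_fun s).
Proof. by case: s => s /= /asboolP[]. Qed.
Lemma pullback_out U (s : psec U) x : ~ oset U x -> pullback_fun s x = 0.
Proof. by case: s => s /= /asboolP[_]; apply. Qed.
Lemma pullback_eqP U (s t : psec U) :
  (forall x, oset U x -> pullback_fun s x = pullback_fun t x) -> s = t.
Proof.
move=> e; apply: val_inj; apply: functional_extensionality_dep => x /=.
by case: (pselect (oset U x)) => Ux; [exact: e | rewrite !pullback_out].
Qed.

Definition mkpullback_fun U (s : forall x, pullback_stalk f F x) :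
  zprod (pullback_stalk f F) := fun x => if `[< oset U x >] then s x else 0.
Lemma mkpullback_subproof U s : pullback_local f F U s ->
  mkpullback_fun U s \in pullback_pred f F U.
Proof.
move=> hs; apply/asboolP; split; last first.
  by move=> x Ux; rewrite /mkpullback_fun asboolF.
apply: pullback_local_glue => x Ux; exists U, s; split => // y Uy.
by rewrite /mkpullback_fun asboolT.
Qed.
Definition mkpullback U s (hs : pullback_local f F U s) : psec U :=
  PullbackSec (mkpullback_subproof hs).
Lemma mkpullbackE U s (hs : pullback_local f F U s) x :
  oset U x -> pullback_fun (mkpullback hs) x = s x.
Proof. by move=> Ux; rewrite /= /mkpullback_fun asboolT. Qed.

Definition pullback_scale U (a : regfun U) (s : psec U) : psec U :=
  mkpullback (pullback_localZ a (@pullback_loc U s)).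
Definition pullback_res U V (h : V `<=` U) (s : psec U) : psec V :=
  mkpullback (pullback_local_res h (@pullback_loc U s)).

Lemma pullback_scaleE U (a : regfun U) (s : psec U) x :
  oset U x -> pullback_fun (pullback_scale a s) x = fgerm x a *: pullback_fun s x.
Proof. exact: mkpullbackE. Qed.
Lemma pullback_resE U V (h : V `<=` U) (s : psec U) x :
  oset V x -> pullback_fun (pullback_res h s) x = pullback_fun s x.
Proof. exact: mkpullbackE. Qed.
Lemma pullbackD_val U (s t : psec U) x : pullback_fun (s + t) x = pullback_fun s x + pullback_fun t x.
Proof. by []. Qed.

Fact pullback_scaleA U (a b : regfun U) (s : psec U) :
  pullback_scale a (pullback_scale b s) = pullback_scale (a * b) s.
Proof.
by apply: pullback_eqP => x Ux; rewrite !pullback_scaleE // fgermM scalerA.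
Qed.
Fact pullback_scale1 U : left_id 1 (@pullback_scale U).
Proof.
by move=> s; apply: pullback_eqP => x Ux; rewrite pullback_scaleE // fgerm1 // scale1r.
Qed.
Fact pullback_scaleDr U : right_distributive (@pullback_scale U) +%R.
Proof.
move=> a s t; apply: pullback_eqP => x Ux.
by rewrite !(pullback_scaleE, pullbackD_val) // scalerDr.
Qed.
Fact pullback_scaleDl U (s : psec U) :
  {morph (@pullback_scale U)^~ s : a b / a + b}.
Proof.
move=> a b; apply: pullback_eqP => x Ux.
by rewrite !(pullback_scaleE, pullbackD_val) // fgermD scalerDl.
Qed.
HB.instance Definition _ U := GRing.Zmodule_isLmodule.Build (regfun U) (psec U)
  (@pullback_scaleA U) (@pullback_scale1 U) (@pullback_scaleDr U)
  (@pullback_scaleDl U).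

Fact pullback_resD U V (h : V `<=` U) (s t : psec U) :
  pullback_res h (s + t) = pullback_res h s + pullback_res h t.
Proof.
apply: pullback_eqP => x Vx.
by rewrite pullbackD_val !pullback_resE.
Qed.
Fact pullback_resZ U V (h : V `<=` U) (a : regfun U) (s : psec U) :
  pullback_res h (a *: s) = rrestr h a *: pullback_res h s.
Proof.
apply: pullback_eqP => x Vx; rewrite [RHS]pullback_scaleE // !pullback_resE //.
by rewrite [LHS]pullback_scaleE ?fgerm_res //; exact: h.
Qed.
Fact pullback_res_id U (h : U `<=` U) (s : psec U) : pullback_res h s = s.
Proof. by apply: pullback_eqP => x Ux; rewrite pullback_resE. Qed.
Fact pullback_res_comp U V (W : opens X) (h : V `<=` U) (h' : W `<=` V) (h'' : W `<=` U)
  (s : psec U) : pullback_res h' (pullback_res h s) = pullback_res h'' s.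
Proof.
by apply: pullback_eqP => x Wx; rewrite !pullback_resE //; exact: h'.
Qed.
Fact pullback_sep U (D : set (opens X)) (s t : psec U) :
  (forall V, D V -> V `<=` U) ->
  (forall x, oset U x -> exists2 V, D V & oset V x) ->
  (forall (V : opens X) (h : V `<=` U), D V ->
    pullback_res h s = pullback_res h t) -> s = t.
Proof.
move=> DU cov e; apply: pullback_eqP => x /cov[V DV Vx].
by rewrite -(pullback_resE (DU _ DV) s Vx) e // pullback_resE.
Qed.
Fact pullback_glue U (D : set (opens X)) (s : forall V, psec V) :
  (forall V, D V -> V `<=` U) ->
  (forall x, oset U x -> exists2 V, D V & oset V x) ->
  (forall V W, D V -> D W -> pullback_res (@openIl _ _ V W) (s V)
     = pullback_res (@openIr _ _ V W) (s W)) ->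
  exists t : psec U, forall (V : opens X) (h : V `<=` U), D V ->
    pullback_res h t = s V.
Proof.
move=> DU cov agr.
pose g x : pullback_stalk f F x := if pselect (oset U x) is left Ux
  then pullback_fun (s (projT1 (cid2 (cov x Ux)))) x else 0.
have gE V x : D V -> oset V x -> g x = pullback_fun (s V) x.
  move=> DV Vx; rewrite /g; case: pselect => [Ux|]; last by case; exact: DU Vx.
  case: cid2 => W DW Wx /=.
  have := congr1 (fun k : psec _ => pullback_fun k x) (agr _ _ DV DW).
  by rewrite !pullback_resE.
have hg : pullback_local f F U g.
  apply: pullback_local_glue => x /cov[V DV Vx]; exists V, (pullback_fun (s V)); split => //.
  - exact: DU.
  - exact: pullback_loc.
  - by move=> y; exact: gE.
exists (mkpullback hg) => V h DV; apply: pullback_eqP => x Vx.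
by rewrite pullback_resE // mkpullbackE; [exact: gE | exact: h].
Qed.

Definition pullback : omod X := @OMod R X (fun U => psec U) pullback_res
  pullback_resD pullback_resZ pullback_res_id pullback_res_comp
  pullback_sep pullback_glue.

End PullbackTheory.

(* Direct sum of a family of sheaves of modules.  The presheaf direct sum     *)
(* consists of the families with finitely many nonzero components; its        *)
(* sheafification consists of the locally finite families.                    *)
Section DirectSum.
Variables (R : realType) (X : rspace R) (I : Type) (F : I -> omod X).
Implicit Types U V W : opens X.

Definition dsum_local U (s : forall i, F i U) :=
  forall x, oset U x -> exists (V : opens X) (h : V `<=` U),
    oset V x /\ finite_set [set i | res h (s i) <> 0].

Definition dsum_pred U : {pred zprod (fun i => F i U)} :=
  [pred s | `[< dsum_local s >]].

Record dsum_sec U := DsumSec {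
  dsum_fun : zprod (fun i => F i U);
  dsumP : dsum_fun \in @dsum_pred U }.

End DirectSum.

HB.instance Definition _ R (X : rspace R) I (F : I -> omod X) (U : opens X) :=
  [isSub for @dsum_fun R X I F U].
HB.instance Definition _ R (X : rspace R) I (F : I -> omod X) (U : opens X) :=
  [Choice of @dsum_sec R X I F U by <:].

Section DirectSumTheory.
Variables (R : realType) (X : rspace R) (I : Type) (F : I -> omod X).
Implicit Types U V W : opens X.
Local Notation dsec := (dsum_sec F).

Fact dsum_zmod_closed U : zmod_closed (@dsum_pred R X I F U).
Proof.
split.
  apply/asboolP => x Ux; exists U, (@subset_refl _ _); split => //.
  apply: (sub_finite_set (B := set0)); last exact: finite_set0.
  by move=> i /=; rewrite res0.
move=> s t /asboolP hs /asboolP ht; apply/asboolP => x Ux.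
have [V [VU [Vx fV]]] := hs x Ux; have [W [WU [Wx fW]]] := ht x Ux.
have hV := @openIl _ _ V W; have hW := @openIr _ _ V W.
exists (openI V W), (subset_trans hV VU); split => //.
apply: (sub_finite_set (B := [set i | res VU (s i) <> 0] `|`
                             [set i | res WU (t i) <> 0])); last first.
  by rewrite finite_setU.
move=> i /= st; apply: contrapT => /not_orP[/contrapT es /contrapT et]; apply: st.
have -> : (s - t) i = s i - t i by [].
rewrite resD resN -(res_comp VU hV) es res0 -(res_comp WU hW).
by rewrite et res0 subr0.
Qed.
HB.instance Definition _ U := GRing.isZmodClosed.Build
  (zprod (fun i => F i U)) (@dsum_pred R X I F U) (dsum_zmod_closed U).
HB.instance Definition _ U := [SubChoice_isSubZmodule of dsec U by <:].

Lemma dsum_loc U (s : dsec U) : dsum_local (dsum_fun s).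
Proof. by case: s => s /= /asboolP. Qed.
Lemma dsum_eqP U (s t : dsec U) :
  (forall i, dsum_fun s i = dsum_fun t i) -> s = t.
Proof.
by move=> e; apply: val_inj; apply: functional_extensionality_dep => i; exact: e.
Qed.

Lemma mkdsum_subproof U (s : forall i, F i U) :
  dsum_local s -> (s : zprod _) \in @dsum_pred R X I F U.
Proof. by move=> h; apply/asboolP. Qed.
Definition mkdsum U (s : forall i, F i U) (h : dsum_local s) : dsec U :=
  DsumSec (mkdsum_subproof h).

Lemma dsum_scale_subproof U (a : regfun U) (s : dsec U) :
  dsum_local (fun i => a *: dsum_fun s i).
Proof.
move=> x /(dsum_loc s)[V [VU [Vx fV]]]; exists V, VU; split => //.
apply: sub_finite_set fV => i /= h e; apply: h.
by rewrite resZ e scaler0.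
Qed.
Definition dsum_scale U (a : regfun U) (s : dsec U) : dsec U :=
  mkdsum (dsum_scale_subproof a s).

Lemma dsum_res_subproof U V (h : V `<=` U) (s : dsec U) :
  dsum_local (fun i => res h (dsum_fun s i)).
Proof.
move=> x Vx; have [W [WU [Wx fW]]] := dsum_loc s (h _ Vx).
have hV := @openIr _ _ W V; have hW := @openIl _ _ W V.
exists (openI W V), hV; split => //; apply: sub_finite_set fW => i /= e es.
by apply: e; rewrite (res_comp _ _ (subset_trans hW WU)) -(res_comp WU hW) es res0.
Qed.
Definition dsum_res U V (h : V `<=` U) (s : dsec U) : dsec V :=
  mkdsum (dsum_res_subproof h s).

Fact dsum_scaleA U (a b : regfun U) (s : dsec U) :
  dsum_scale a (dsum_scale b s) = dsum_scale (a * b) s.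
Proof. by apply: dsum_eqP => i; exact: scalerA. Qed.
Fact dsum_scale1 U : left_id 1 (@dsum_scale U).
Proof. by move=> s; apply: dsum_eqP => i; exact: scale1r. Qed.
Fact dsum_scaleDr U : right_distributive (@dsum_scale U) +%R.
Proof. by move=> a s t; apply: dsum_eqP => i; exact: scalerDr. Qed.
Fact dsum_scaleDl U (s : dsec U) :
  {morph (@dsum_scale U)^~ s : a b / a + b}.
Proof. by move=> a b; apply: dsum_eqP => i; exact: scalerDl. Qed.
HB.instance Definition _ U := GRing.Zmodule_isLmodule.Build (regfun U) (dsec U)
  (@dsum_scaleA U) (@dsum_scale1 U) (@dsum_scaleDr U) (@dsum_scaleDl U).

Fact dsum_resD U V (h : V `<=` U) (s t : dsec U) :
  dsum_res h (s + t) = dsum_res h s + dsum_res h t.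
Proof. by apply: dsum_eqP => i; exact: resD. Qed.
Fact dsum_resZ U V (h : V `<=` U) (a : regfun U) (s : dsec U) :
  dsum_res h (a *: s) = rrestr h a *: dsum_res h s.
Proof. by apply: dsum_eqP => i; exact: resZ. Qed.
Fact dsum_res_id U (h : U `<=` U) (s : dsec U) : dsum_res h s = s.
Proof. by apply: dsum_eqP => i; exact: res_id. Qed.
Fact dsum_res_comp U V W (h : V `<=` U) (h' : W `<=` V) (h'' : W `<=` U)
  (s : dsec U) : dsum_res h' (dsum_res h s) = dsum_res h'' s.
Proof. by apply: dsum_eqP => i; exact: res_comp. Qed.
Fact dsum_sep U (D : set (opens X)) (s t : dsec U) :
  (forall V, D V -> V `<=` U) ->
  (forall x, oset U x -> exists2 V, D V & oset V x) ->
  (forall V (h : V `<=` U), D V -> dsum_res h s = dsum_res h t) -> s = t.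
Proof.
move=> DU cov e; apply: dsum_eqP => i; apply: (sheaf_sep DU cov) => V h DV.
exact: (congr1 (fun k : dsec V => dsum_fun k i) (e V h DV)).
Qed.
Fact dsum_glue U (D : set (opens X)) (s : forall V, dsec V) :
  (forall V, D V -> V `<=` U) ->
  (forall x, oset U x -> exists2 V, D V & oset V x) ->
  (forall V W, D V -> D W -> dsum_res (@openIl _ _ V W) (s V)
     = dsum_res (@openIr _ _ V W) (s W)) ->
  exists t : dsec U, forall V (h : V `<=` U), D V -> dsum_res h t = s V.
Proof.
move=> DU cov agr.
have agri i V W : D V -> D W ->
    res (@openIl _ _ V W) (dsum_fun (s V) i) = res (@openIr _ _ V W) (dsum_fun (s W) i).
  by move=> DV DW; exact: (congr1 (fun k : dsec _ => dsum_fun k i) (agr V W DV DW)).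
pose t i := projT1 (cid (sheaf_glue (s := fun V => dsum_fun (s V) i) DU cov (agri i))).
have tE i V (h : V `<=` U) : D V -> res h (t i) = dsum_fun (s V) i.
  by move=> DV; rewrite /t; case: cid => /= k; exact.
have ht : dsum_local t.
  move=> x /cov[V DV Vx]; have [W [WV [Wx fW]]] := dsum_loc (s V) Vx.
  exists W, (subset_trans WV (DU _ DV)); split => //.
  apply: sub_finite_set fW => i /= e es; apply: e.
  by rewrite -(res_comp (DU _ DV) WV) tE.
by exists (mkdsum ht) => V h DV; apply: dsum_eqP => i; exact: tE.
Qed.

Definition dsum : omod X := @OMod R X (fun U => dsec U) dsum_res
  dsum_resD dsum_resZ dsum_res_id dsum_res_comp dsum_sep dsum_glue.

End DirectSumTheory.

Definition free_sheaf (R : realType) (X : rspace R) (I : Type) : omod X :=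
  dsum (fun _ : I => struct_sheaf X).

Section Homomorphisms.
Variables (R : realType) (X : rspace R).

(* Homomorphisms F|U -> G|U; the values of phi on open sets that are not      *)
(* contained in U are irrelevant.                                             *)
Definition is_hom (U : opens X) (F G : omod X) (phi : forall V, F V -> G V) :=
  [/\ forall (V : opens X) (s t : F V), V `<=` U ->
        phi V (s + t) = phi V s + phi V t,
      forall (V : opens X) (a : regfun V) (s : F V), V `<=` U ->
        phi V (a *: s) = a *: phi V s &
      forall (V W : opens X) (h : W `<=` V) (s : F V), V `<=` U ->
        phi W (res h s) = res h (phi V s)].

Definition isomorphic_on (U : opens X) (F G : omod X) :=
  exists (phi : forall V, F V -> G V) (psi : forall V, G V -> F V),
  [/\ is_hom U phi, is_hom U psi &
    forall V : opens X, V `<=` U ->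
      cancel (phi V) (psi V) /\ cancel (psi V) (phi V)].

(* psi : G|U -> H|U is a cokernel of phi : F|U -> G|U. *)
Definition is_cokernel (U : opens X) (F G H : omod X)
    (phi : forall V, F V -> G V) (psi : forall V, G V -> H V) :=
  [/\ is_hom U phi, is_hom U psi,
    forall (V : opens X) (t : H V) x, V `<=` U -> oset V x ->
      exists (W : opens X) (h : W `<=` V) (s : G W),
        oset W x /\ psi W s = res h t &
    forall (V : opens X) (s : G V), V `<=` U ->
      psi V s = 0 <->
      forall x, oset V x -> exists (W : opens X) (h : W `<=` V) (r : F W),
        oset W x /\ phi W r = res h s].

Definition quasi_coherent (F : omod X) :=
  exists (m : nat) (U : 'I_m -> opens X),
    (forall x, exists i, oset (U i) x) /\
    forall i, exists (I J : Type)
        (phi : forall V, free_sheaf X I V -> free_sheaf X J V)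
        (psi : forall V, free_sheaf X J V -> F V),
      is_cokernel (U i) phi psi.

Definition locally_free_infinite (F : omod X) :=
  forall x, exists (U : opens X) (I : Type),
    [/\ oset U x, infinite_set [set: I] & isomorphic_on U F (free_sheaf X I)].

End Homomorphisms.

Section Algebraic.
Variables (R : realType) (n : nat).
Implicit Types (S : set {mpoly R[n]}) (A Z : set 'rV[R]_n).

Definition peval (p : {mpoly R[n]}) (x : 'rV[R]_n) : R := p.@[x 0].

Definition zeros S : set 'rV[R]_n := [set x | forall p, S p -> peval p x = 0].
Definition ideal_of A : set {mpoly R[n]} :=
  [set p | forall x, A x -> peval p x = 0].
Definition zclosure A : set 'rV[R]_n := zeros (ideal_of A).
Definition algebraic A := exists S, A = zeros S.

Lemma pevalD p q x : peval (p + q) x = peval p x + peval q x.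
Proof. exact: mevalD. Qed.
Lemma pevalB p q x : peval (p - q) x = peval p x - peval q x.
Proof. exact: mevalB. Qed.
Lemma pevalM p q x : peval (p * q) x = peval p x * peval q x.
Proof. exact: mevalM. Qed.
Lemma pevalC c x : peval c%:MP x = c.
Proof. exact: mevalC. Qed.
Lemma peval1 x : peval 1 x = 1.
Proof. exact: meval1. Qed.
Lemma pevalX i x : peval 'X_i x = x 0 i.
Proof. exact: mevalXU. Qed.

(* Zariski topology and regular functions on a subset A of R^n. *)
Section Affine.
Variable A : set 'rV[R]_n.

Definition affine_open (U : set A) :=
  exists S, U = [set x | ~ zeros S (val x)].

Definition affine_regular (U : set A) (f : A -> R) :=
  forall x, U x -> exists p q, peval q (val x) != 0 /\
    forall y, U y -> peval q (val y) != 0 ->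
      f y = peval p (val y) / peval q (val y).

Fact affine_openT : affine_open setT.
Proof.
exists [set 1]; apply/seteqP; split=> // x _ /(_ 1 erefl) /eqP.
by rewrite peval1 oner_eq0.
Qed.
Fact affine_openI U V : affine_open U -> affine_open V -> affine_open (U `&` V).
Proof.
move=> [S ->] [T ->]; exists [set r | exists p q, [/\ S p, T q & r = p * q]].
apply/seteqP; split=> x /=.
  move=> [hS hT] h; apply: hS => p Sp; apply: contrapT => /eqP px; apply: hT => q Tq.
  have /eqP := h (p * q) (ex_intro _ p (ex_intro _ q (And3 Sp Tq erefl))).
  by rewrite pevalM mulf_eq0 (negbTE px) /= => /eqP.
move=> h; split=> h'; apply: h => _ [p [q [Sp Tq ->]]].
  by rewrite pevalM h' ?mul0r.
by rewrite pevalM (h' q) ?mulr0.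
Qed.
Fact affine_openU (D : set (set A)) :
  D `<=` affine_open -> affine_open (\bigcup_(U in D) U).
Proof.
move=> DO; exists [set p | exists S, D [set x | ~ zeros S (val x)] /\ S p].
apply/seteqP; split=> x /=.
  move=> [U DU Ux] h; have [S eU] := DO U DU; rewrite eU in DU Ux.
  by apply: Ux => p Sp; apply: h; exists S.
move=> h; apply: contrapT => h'; apply: h => p [S [DS Sp]].
apply: contrapT => px; apply: h'; exists [set x | ~ zeros S (val x)] => //=.
by move=> hS; apply: px; exact: hS.
Qed.
Fact affine_regular_sub U V f : affine_open U -> affine_open V -> V `<=` U ->
  affine_regular U f -> affine_regular V f.
Proof.
move=> _ _ VU rf x /VU /rf[p [q [qx e]]]; exists p, q; split => // y /VU.
exact: e.
Qed.
Fact affine_regular_local U f : affine_open U ->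
  (forall x, U x -> exists V g, [/\ affine_open V, V x, V `<=` U,
     affine_regular V g & forall y, V y -> f y = g y]) ->
  affine_regular U f.
Proof.
move=> _ h x /h[V [g [[S ->] Vx VU rg e]]].
have [p [q [qx e']]] := rg x Vx.
have [k Sk kx] : exists2 k, S k & peval k (val x) != 0.
  apply: contrapT => h'; apply: Vx => k Sk; apply: contrapT => /eqP kx.
  by apply: h'; exists k.
exists (p * k), (q * k); rewrite pevalM mulf_neq0 //; split => // y Uy.
rewrite !pevalM mulf_eq0 negb_or => /andP[qy ky].
have Vy : ~ zeros S (val y) by move=> /(_ k Sk) /eqP; rewrite (negbTE ky).
by rewrite e // e' // -mulf_div divff // mulr1.
Qed.
Fact affine_regular_cst U c : affine_open U -> affine_regular U (fun=> c).
Proof.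
move=> _ x _; exists c%:MP, 1; rewrite peval1 oner_neq0; split => // y _ _.
by rewrite pevalC peval1 divr1.
Qed.
Fact affine_regularB U f g : affine_open U -> affine_regular U f ->
  affine_regular U g -> affine_regular U (fun x => f x - g x).
Proof.
move=> _ rf rg x Ux; have [p [q [qx e]]] := rf x Ux.
have [p' [q' [q'x e']]] := rg x Ux.
exists (p * q' - p' * q), (q * q'); rewrite pevalM mulf_neq0 //; split => // y Uy.
rewrite pevalM mulf_eq0 negb_or => /andP[qy q'y].
by rewrite e // e' // pevalB !pevalM -mulNr addf_div // mulNr.
Qed.
Fact affine_regularM U f g : affine_open U -> affine_regular U f ->
  affine_regular U g -> affine_regular U (fun x => f x * g x).
Proof.
move=> _ rf rg x Ux; have [p [q [qx e]]] := rf x Ux.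
have [p' [q' [q'x e']]] := rg x Ux.
exists (p * p'), (q * q'); rewrite pevalM mulf_neq0 //; split => // y Uy.
rewrite !pevalM mulf_eq0 negb_or => /andP[qy q'y].
by rewrite e // e' // mulf_div.
Qed.

Definition affine : rspace R := @RSpace R A affine_open affine_regular
  affine_openT affine_openI affine_openU affine_regular_sub
  affine_regular_local affine_regular_cst affine_regularB affine_regularM.

Fact affine_openC1 (a : 'rV[R]_n) : affine_open [set x | val x != a].
Proof.
exists [set p | exists i, p = 'X_i - (a 0 i)%:MP]; apply/seteqP; split=> x /=.
  move=> /eqP xa h; apply: xa; apply/rowP => i.
  by have := h _ (ex_intro _ i erefl); rewrite pevalB pevalX pevalC => /subr0_eq.
move=> h; apply/eqP => xa; apply: h => _ [i ->].
by rewrite pevalB pevalX pevalC xa subrr.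
Qed.
Definition affineC1 (a : 'rV[R]_n) : opens affine := @Opens _ affine _ (affine_openC1 a).
End Affine.

(* Z is nonsingular at z (Jacobian criterion): near z, Z is cut out by        *)
(* polynomials vanishing on Z with linearly independent differentials at z.   *)
Definition smooth_at Z (z : 'rV[R]_n) :=
  exists (c : nat) (P : 'I_c -> {mpoly R[n]}) (h : {mpoly R[n]}),
  [/\ forall i, ideal_of Z (P i),
      peval h z != 0,
      forall x, peval h x != 0 -> (forall i, peval (P i) x = 0) -> Z x &
      row_free (\matrix_(i < c, j < n) peval ((P i)^`M(j)) z)].
Definition smooth Z := forall z, Z z -> smooth_at Z z.

(* The restrictions of the f i to A generate the ideal of Z in the ring of    *)
(* polynomial functions on A.                                                 *)
Definition generates A Z (r : nat) (f : 'I_r -> {mpoly R[n]}) :=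
  (forall i, ideal_of Z (f i)) /\
  forall g, ideal_of Z g -> exists a : 'I_r -> {mpoly R[n]},
    forall x, A x -> peval g x = \sum_(i < r) peval (a i) x * peval (f i) x.

End Algebraic.

(* P^(r-1)(R) is identified with the algebraic set of orthogonal projections  *)
(* of rank one of R^r: the class of v is sent to v^T v / (v v^T).             *)
Definition proj_point (R : realType) (r : nat) (v : 'rV[R]_r) : 'rV[R]_(r * r) :=
  mxvec ((\sum_(i < r) v 0 i ^+ 2)^-1 *: (v^T *m v)).

(* The blowup of A along Z: the Zariski closure in A x P^(r-1) of the graph   *)
(* of (f_1 : ... : f_r) on A \ Z.                                             *)
Definition blowup_set (R : realType) (n : nat) (A Z : set 'rV[R]_n) (r : nat)
    (f : 'I_r -> {mpoly R[n]}) : set 'rV[R]_(n + r * r) :=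
  zclosure [set row_mx x (proj_point (\row_i peval (f i) x)) | x in A `\` Z].

(* pi : Y -> X is the blowup of the affine real algebraic variety X along a   *)
(* smooth nowhere dense closed subvariety, up to isomorphism.                 *)
Definition is_blowup (R : realType) (Y X : rspace R) (pi : rmap Y X) :=
  exists (n : nat) (A Z : set 'rV[R]_n) (r : nat) (f : 'I_r -> {mpoly R[n]})
    (e : rmap X (affine A)) (e' : rmap Y (affine (blowup_set A Z f))),
  [/\ algebraic A, algebraic Z & Z `<=` A] /\
  [/\ smooth Z, A `<=` zclosure (A `\` Z), generates A Z f,
    rmap_iso e /\ rmap_iso e' &
    forall y, lsubmx (val (e' y)) = val (e (pi y))].

Inductive multi_blowup (R : realType) (B : rspace R) :
    forall X : rspace R, rmap X B -> Prop :=
| multi_blowup_id : multi_blowup (rmap_id B)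
| multi_blowup_comp (X Y : rspace R) (a : rmap X B) (pi : rmap Y X) :
    multi_blowup a -> is_blowup pi -> multi_blowup (rmap_comp a pi).

Section Fkl.
Variable R : realType.

Definition plane : rspace R := affine [set: 'rV[R]_2].

Definition Pkl (k l : nat) (x : plane) : R :=
  let u := val x 0 0 in let v := val x 0 1 in
  u ^+ (2 * k) * (u - 1) ^+ (2 * l) + v ^+ 2.

Definition c1 : 'rV[R]_2 := 0.
Definition c2 : 'rV[R]_2 := delta_mx 0 0.
Definition U1 : opens plane := affineC1 setT c1.
Definition U2 : opens plane := affineC1 setT c2.

Variables k l : nat.
Implicit Types V W : opens plane.

Definition fkl_pred V : {pred regfun (openI U1 V) * regfun (openI U2 V)} :=
  [pred s : regfun (openI U1 V) * regfun (openI U2 V) |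
    `[< forall x, (oset U1 `&` oset U2 `&` oset V) x ->
                 Pkl k l x * s.1 x = s.2 x >]].

Record fkl_sec V := FklSec {
  fkl_pair : regfun (openI U1 V) * regfun (openI U2 V);
  fklP : fkl_pair \in @fkl_pred V }.

End Fkl.

HB.instance Definition _ R k l (V : opens (plane R)) :=
  [isSub for @fkl_pair R k l V].
HB.instance Definition _ R k l (V : opens (plane R)) :=
  [Choice of @fkl_sec R k l V by <:].

Section FklTheory.
Variables (R : realType) (k l : nat).
Implicit Types U V W : opens (plane R).
Local Notation fsec := (@fkl_sec R k l).

Fact fkl_zmod_closed V : zmod_closed (@fkl_pred R k l V).
Proof.
split; first by apply/asboolP => x _; exact: mulr0.
move=> s t /asboolP hs /asboolP ht; apply/asboolP => x Ux.
by rewrite [(s - t).1 x]regfunB_val mulrBr hs // ht // [RHS]regfunB_val.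
Qed.
HB.instance Definition _ V := GRing.isZmodClosed.Build
  (regfun (openI (U1 R) V) * regfun (openI (U2 R) V))%type
  (@fkl_pred R k l V) (fkl_zmod_closed V).
HB.instance Definition _ V := [SubChoice_isSubZmodule of fsec V by <:].

Lemma fkl_glue_eq V (s : fsec V) x :
  oset (U1 R) x -> oset (U2 R) x -> oset V x ->
  Pkl k l x * (fkl_pair s).1 x = (fkl_pair s).2 x.
Proof. by case: s => s /= /asboolP h *; apply: h. Qed.
Lemma fkl_eqP V (s t : fsec V) :
  (fkl_pair s).1 = (fkl_pair t).1 -> (fkl_pair s).2 = (fkl_pair t).2 -> s = t.
Proof.
move=> e1 e2; apply: val_inj => /=.
by case: (fkl_pair s) (fkl_pair t) e1 e2 => [? ?] [? ?] /= -> ->.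
Qed.

Lemma openIS U V W : V `<=` U -> openI W V `<=` openI W U.
Proof. by move=> h x [? /h]. Qed.

Lemma fkl_scale_subproof V (a : regfun V) (s : fsec V) :
  (rrestr (@openIr _ _ (U1 R) V) a * (fkl_pair s).1,
   rrestr (@openIr _ _ (U2 R) V) a * (fkl_pair s).2) \in @fkl_pred R k l V.
Proof.
apply/asboolP => x [[h1 h2] hV].
by rewrite [_.1]/= [_.2]/= !regfun_mulE !rrestrE // mulrCA fkl_glue_eq.
Qed.
Definition fkl_scale V (a : regfun V) (s : fsec V) : fsec V :=
  FklSec (fkl_scale_subproof a s).

Lemma fkl_res_subproof V W (h : W `<=` V) (s : fsec V) :
  (rrestr (openIS h) (fkl_pair s).1, rrestr (openIS h) (fkl_pair s).2)
    \in @fkl_pred R k l W.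
Proof.
apply/asboolP => x [[h1 h2] hW].
by rewrite [_.1]/= [_.2]/= !rrestrE // fkl_glue_eq //; exact: h.
Qed.
Definition fkl_res V W (h : W `<=` V) (s : fsec V) : fsec W :=
  FklSec (fkl_res_subproof h s).

Fact fkl_scaleA V (a b : regfun V) (s : fsec V) :
  fkl_scale a (fkl_scale b s) = fkl_scale (a * b) s.
Proof. by apply: fkl_eqP; rewrite /= rrestrM mulrA. Qed.
Fact fkl_scale1 V : left_id 1 (@fkl_scale V).
Proof. by move=> s; apply: fkl_eqP; rewrite /= rrestr1 mul1r. Qed.
Fact fkl_scaleDr V : right_distributive (@fkl_scale V) +%R.
Proof. by move=> a s t; apply: fkl_eqP; exact: mulrDr. Qed.
Fact fkl_scaleDl V (s : fsec V) : {morph (@fkl_scale V)^~ s : a b / a + b}.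
Proof. by move=> a b; apply: fkl_eqP; rewrite /= rrestrD mulrDl. Qed.
HB.instance Definition _ V := GRing.Zmodule_isLmodule.Build (regfun V) (fsec V)
  (@fkl_scaleA V) (@fkl_scale1 V) (@fkl_scaleDr V) (@fkl_scaleDl V).

Fact fkl_resD V W (h : W `<=` V) (s t : fsec V) :
  fkl_res h (s + t) = fkl_res h s + fkl_res h t.
Proof. by apply: fkl_eqP; exact: rrestrD. Qed.
Fact fkl_resZ V W (h : W `<=` V) (a : regfun V) (s : fsec V) :
  fkl_res h (a *: s) = rrestr h a *: fkl_res h s.
Proof.
have hr (C : opens (plane R)) : openI C W `<=` V by move=> x [_ /h].
apply: fkl_eqP; rewrite /= rrestrM; congr (_ * _).
- by rewrite (rrestr_comp _ _ (hr (U1 R))) (rrestr_comp _ _ (hr (U1 R))).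
- by rewrite (rrestr_comp _ _ (hr (U2 R))) (rrestr_comp _ _ (hr (U2 R))).
Qed.
Fact fkl_res_id V (h : V `<=` V) (s : fsec V) : fkl_res h s = s.
Proof. by apply: fkl_eqP; exact: rrestr_id. Qed.
Fact fkl_res_comp U V W (h : V `<=` U) (h' : W `<=` V) (h'' : W `<=` U)
  (s : fsec U) : fkl_res h' (fkl_res h s) = fkl_res h'' s.
Proof. by apply: fkl_eqP; exact: rrestr_comp. Qed.

Fact fkl_sep U (D : set (opens (plane R))) (s t : fsec U) :
  (forall V, D V -> V `<=` U) ->
  (forall x, oset U x -> exists2 V, D V & oset V x) ->
  (forall (V : opens (plane R)) (h : V `<=` U), D V ->
    fkl_res h s = fkl_res h t) -> s = t.
Proof.
move=> DU cov e.
have eq1 V (h : V `<=` U) : D V ->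
    rrestr (openIS h) (fkl_pair s).1 = rrestr (openIS h) (fkl_pair t).1.
  by move=> DV; exact: (congr1 (fun z : fsec _ => (fkl_pair z).1) (e V h DV)).
have eq2 V (h : V `<=` U) : D V ->
    rrestr (openIS h) (fkl_pair s).2 = rrestr (openIS h) (fkl_pair t).2.
  by move=> DV; exact: (congr1 (fun z : fsec _ => (fkl_pair z).2) (e V h DV)).
apply: fkl_eqP; apply: regfun_eqP => x [hx /cov[V DV Vx]].
  have := congr1 (fun g : regfun _ => g x) (eq1 V (DU _ DV) DV).
  by rewrite !rrestrE.
have := congr1 (fun g : regfun _ => g x) (eq2 V (DU _ DV) DV).
by rewrite !rrestrE.
Qed.
Fact fkl_glue U (D : set (opens (plane R))) (s : forall V, fsec V) :
  (forall V, D V -> V `<=` U) ->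
  (forall x, oset U x -> exists2 V, D V & oset V x) ->
  (forall V W, D V -> D W -> fkl_res (@openIl _ _ V W) (s V)
     = fkl_res (@openIr _ _ V W) (s W)) ->
  exists t : fsec U, forall (V : opens (plane R)) (h : V `<=` U), D V ->
    fkl_res h t = s V.
Proof.
move=> DU cov agr.
have glue C (g : forall V, regfun (openI C V)) :
    (forall V W x, D V -> D W -> oset C x -> oset V x -> oset W x ->
       g V x = g W x) ->
    exists t : regfun (openI C U), forall V x, D V -> oset C x -> oset V x ->
      t x = g V x.
  move=> ag.
  pose f x := if pselect (oset U x) is left Ux
              then g (projT1 (cid2 (cov x Ux))) x else 0.
  have fE V x : D V -> oset C x -> oset V x -> f x = g V x.
    move=> DV Cx Vx; rewrite /f; case: pselect => [Ux|]; last by case; exact: DU Vx.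
    by case: cid2 => W DW Wx /=; exact: ag.
  have rf : zregular (openI C U) f.
    apply: zregular_local; first exact: opensP.
    move=> x [Cx /cov[V DV Vx]]; exists (openI C V), (g V); split => //.
    - exact: opensP.
    - exact: openIS (DU _ DV).
    - exact: regfun_reg.
    - by move=> y [Cy Vy]; exact: fE.
  exists (mkregfun rf) => V x DV Cx Vx; rewrite mkregfunE; first exact: fE.
  by split => //; exact: DU Vx.
have [t1 e1] : exists t : regfun (openI (U1 R) U), forall V x, D V ->
    oset (U1 R) x -> oset V x -> t x = (fkl_pair (s V)).1 x.
  apply: glue => V W x DV DW Cx Vx Wx.
  have := congr1 (fun z : fsec _ => (fkl_pair z).1 x) (agr V W DV DW).
  by rewrite [LHS]rrestrE // [X in _ = X]rrestrE.
have [t2 e2] : exists t : regfun (openI (U2 R) U), forall V x, D V ->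
    oset (U2 R) x -> oset V x -> t x = (fkl_pair (s V)).2 x.
  apply: glue => V W x DV DW Cx Vx Wx.
  have := congr1 (fun z : fsec _ => (fkl_pair z).2 x) (agr V W DV DW).
  by rewrite [LHS]rrestrE // [X in _ = X]rrestrE.
have ht : (t1, t2) \in @fkl_pred R k l U.
  apply/asboolP => x [[h1 h2] /cov[V DV Vx]].
  by rewrite [_.1]/= [_.2]/= (e1 V) // (e2 V) // fkl_glue_eq.
exists (FklSec ht) => V h DV; apply: fkl_eqP; apply: regfun_eqP => x [hx Vx].
  by rewrite [LHS]rrestrE //; exact: e1.
by rewrite [LHS]rrestrE //; exact: e2.
Qed.

Definition Fkl : omod (plane R) := @OMod R (plane R) (fun V => fsec V) fkl_res
  fkl_resD fkl_resZ fkl_res_id fkl_res_comp fkl_sep fkl_glue.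

End FklTheory.

(* The index k : nat stands for k + 1 >= 1. *)
Definition Fsum (R : realType) : omod (plane R) :=
  dsum (fun k : nat => Fkl R k.+1 k.+1).

(* Main.v *)
Require Import Defs.
From HB Require Import structures.
From mathcomp Require Import all_boot all_order all_algebra.
From mathcomp Require Import boolp classical_sets functions cardinality reals.
From mathcomp Require Import mpoly complex ring.
Set Implicit Arguments.
Unset Strict Implicit.
Unset Printing Implicit Defensive.
Import Order.TTheory GRing.Theory Num.Theory.
Local Open Scope ring_scope.
Local Open Scope quotient_scope.
Local Open Scope classical_set_scope.

(* Let w = x (x - 1).  The polynomial P_(k,k) = w ^ 2k + y ^ 2 vanishes along  *)
(* the complex curve y = i w ^ k.  For every rational function on the plane   *)
(* that stays finite when first y and then x tends to 0 (resp. 1), the value  *)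
(* along this curve for large k has the same, real, limit.  Such limits form  *)
(* a valuation ring with real residue field, so they lift through any         *)
(* blowup, whether or not its centre is smooth: for k large, the curve lifts  *)
(* to X_alpha and passes through real points x0, x1 over (0, 0), (1, 0).  A   *)
(* global section of the pullback of F_(k,k) is a pair with s2 = P_(k,k) s1,  *)
(* where s1 is regular at x1, hence finite along the curve.  So s2, regular   *)
(* at x0, vanishes along the curve, hence at x0.                              *)

(** * Limits of rational functions along complex branches *)

(** The threshold beyond which the curves lift depends on the multi-blowup, and the direct sum
    always has a summand beyond it; this is why one sheaf defeats every multi-blowup. The valuation
    is carried by [along_lead], which finds leading terms, and [quot_total]: p / q or q / p has a
    real limit. Hence among generators of the ideal of a centre one dominates ([lim_at_dominant]),
    the ratios to it converge, and the limit is a real point of the blowup ([graph_lim]). Induction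
    on the number of blowups gives [multi_blowup_lifts]. On the sheaf side, linear forms on fibres
    read off the two components of a section of the pullback ([pull_comp]). At a suitable point over
    (0, 0) a component of all global sections vanishes ([pull_comp_vanishes]), whereas a local
    section has that component equal to 1 ([pull_comp_unit]), so its germ is not generated.
    Quasi-coherence and local freeness hold because every F_(k,l) is trivial on the same two charts
    ([Fkl_trivial]). *)

Lemma exists_nonroot (S : idomainType) (p : {poly S}) :
  injective (fun i : nat => i%:R : S) -> p != 0 -> exists i : nat, p.[i%:R] != 0.
Proof.
move=> injS p0; apply: contrapT => h.
have : (size [seq i%:R : S | i <- iota 0 (size p)] < size p)%N.
  apply: max_poly_roots; rewrite ?map_inj_uniq ?iota_uniq //.
  apply/allP => _ /mapP[i _ ->]; apply/eqP; apply: contrapT => /eqP px.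
  by apply: h; exists i.
by rewrite size_map size_iota ltnn.
Qed.

Lemma mpoly_ring_ind n (R : nzRingType) (P : {mpoly R[n]} -> Prop) :
  (forall c, P c%:MP) -> (forall i, P 'X_i) ->
  (forall p q, P p -> P q -> P (p + q)) ->
  (forall p q, P p -> P q -> P (p * q)) -> forall p, P p.
Proof.
move=> PC PX PD PM; elim/mpolyind => [|c m p _ _ Pp]; first by rewrite -mpolyC0.
apply: (PD) => //; rewrite -mul_mpolyC; apply: (PM) => //.
rewrite mpolyXE_id; apply: (big_ind P) => //; first by rewrite -mpolyC1.
move=> i _; elim: (m i) => [|e IH]; first by rewrite expr0 -mpolyC1.
by rewrite exprS; apply: PM.
Qed.

Section Arcs.
Variable R : realType.

(* Polynomial functions on the plane: the outer variable is y, the inner x. *)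
Definition beval (u : plane R) (p : {poly {poly R}}) : R :=
  p.[(val u 0 1)%:P].[val u 0 0].

Lemma bevalD u p q : beval u (p + q) = beval u p + beval u q.
Proof. by rewrite /beval !hornerD. Qed.
Lemma bevalB u p q : beval u (p - q) = beval u p - beval u q.
Proof. by rewrite /beval !hornerE. Qed.
Lemma bevalM u p q : beval u (p * q) = beval u p * beval u q.
Proof. by rewrite /beval !hornerM. Qed.
Lemma beval0 u : beval u 0 = 0.
Proof. by rewrite /beval !horner0. Qed.
Lemma beval_cst u c : beval u c%:P%:P = c.
Proof. by rewrite /beval !hornerC. Qed.
Lemma beval1 u : beval u 1 = 1.
Proof. exact: beval_cst. Qed.
Lemma beval_x u : beval u 'X%:P = val u 0 0.
Proof. by rewrite /beval hornerC hornerX. Qed.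
Lemma beval_y u : beval u 'X = val u 0 1.
Proof. by rewrite /beval hornerX hornerC. Qed.

Lemma beval_mpoly (s : {mpoly R[2]}) :
  exists p, forall u, beval u p = peval s (val u).
Proof.
elim/mpoly_ring_ind: s => [c|i|s t [p hp] [q hq]|s t [p hp] [q hq]].
- by exists c%:P%:P => u; rewrite beval_cst pevalC.
- exists (if i == 0 then 'X%:P else 'X) => u; rewrite pevalX.
  have [->|] := eqVneq i 0; first by rewrite beval_x.
  case: i => [[|[|//]] hi] // _; rewrite beval_y; congr (val u 0 _).
  exact: val_inj.
- by exists (p + q) => u; rewrite bevalD pevalD hp hq.
- by exists (p * q) => u; rewrite bevalM pevalM hp hq.
Qed.

(** Truth off a proper algebraic subset, given by one polynomial so that finite conjunctions are
    handled by products. *)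
Definition generic (Q : plane R -> Prop) :=
  exists2 d, d != 0 & forall u, beval u d != 0 -> Q u.

(** A nonzero polynomial over a domain of characteristic 0 has a nonroot among the natural numbers;
    this is used for y over R[x], then for x over R. *)
Lemma generic_ex Q : generic Q -> exists u, Q u.
Proof.
have natI : injective (fun i : nat => i%:R : R).
  by move=> i j /eqP; rewrite eqr_nat => /eqP.
have polyI : injective (fun i : nat => i%:R : {poly R}).
  by move=> i j; rewrite -!polyC_natr => /polyC_inj /natI.
move=> [d d0 h]; have [y hy] := exists_nonroot polyI d0.
have [x hx] := exists_nonroot natI hy.
pose v : 'rV[R]_2 := \row_i (if i == 0 then x else y)%:R.
have vT : v \in [set: 'rV[R]_2] by rewrite inE.
exists (SigSub vT); apply: h.
by rewrite /beval /= !mxE /= polyC_natr.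
Qed.

Lemma genericW (P Q : plane R -> Prop) :
  (forall u, P u -> Q u) -> generic P -> generic Q.
Proof. by move=> PQ [d d0 h]; exists d => // u /h /PQ. Qed.

Lemma generic_and (P Q : plane R -> Prop) :
  generic P -> generic Q -> generic (fun u => P u /\ Q u).
Proof.
move=> [d d0 h] [e e0 k]; exists (d * e); first by rewrite mulf_neq0.
by move=> u; rewrite bevalM mulf_eq0 negb_or => /andP[/h ? /k].
Qed.

Lemma generic2 (P Q S : plane R -> Prop) : generic P -> generic Q ->
  (forall u, P u -> Q u -> S u) -> generic S.
Proof. by move=> gP gQ h; apply: genericW (generic_and gP gQ) => u []; exact: h. Qed.

Lemma generic_true (P : plane R -> Prop) : (forall u, P u) -> generic P.
Proof. by move=> h; exists 1; rewrite ?oner_neq0. Qed.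

Lemma generic_neq0 p : p != 0 -> generic (fun u => beval u p != 0).
Proof. by exists p. Qed.

Lemma generic_all (I : finType) (P : I -> plane R -> Prop) :
  (forall i, generic (P i)) -> generic (fun u => forall i, P i u).
Proof.
move=> h.
have : generic (fun u => forall i, i \in enum I -> P i u).
  elim: (enum I) => [|i s IH]; first exact: generic_true.
  apply: (generic2 (h i) IH) => u Pi Ps j; rewrite inE => /orP[/eqP->//|].
  exact: Ps.
by apply: genericW => u Pu i; apply: Pu; rewrite mem_enum.
Qed.

Lemma generic_eq0 p : generic (fun u => beval u p = 0) -> p = 0.
Proof.
move=> h; apply: contrapT => /eqP /generic_neq0 p0.
by have [u [-> /eqP]] := generic_ex (generic_and h p0).
Qed.

(* The complex zero y = 'i (x (x - 1)) ^ k of P_(k,k). *)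
Definition branch k : {poly R[i]} := 'i%C *: ('X * ('X - 1)) ^+ k.

(** Restriction to the curve, parametrized by x. A ring morphism, so real polynomial identities pass
    to the complex branch. *)
Definition along k : {poly {poly R}} -> {poly R[i]} :=
  horner_eval (branch k) \o map_poly (map_poly (real_complex R)).

HB.instance Definition _ k := GRing.RMorphism.on (along k).

Lemma alongC k p : along k p%:P = map_poly (real_complex R) p.
Proof. by rewrite /along /= map_polyC /= /horner_eval hornerC. Qed.
Lemma along_cst k c : along k c%:P%:P = (c%:C%C)%:P.
Proof. by rewrite alongC map_polyC. Qed.
Lemma alongX k : along k 'X = branch k.
Proof. by rewrite /along /= map_polyX /= /horner_eval hornerX. Qed.

Section Lim.
(* The base point is (0, 0) for b = false and (1, 0) for b = true. *)
Variable b : bool.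
Local Notation rho := ((b%:R : R)%:C%C).

(** p / q has the real limit c at the base point. It is read on another representative v / u, since
    p and q may both vanish there. *)
Definition quot_lim (p q : {poly R[i]}) (c : R) := exists v u,
  [/\ q != 0, p * u = q * v, u.[rho] != 0 & v.[rho] = c%:C%C * u.[rho]].

Lemma quot_lim_den p q c : quot_lim p q c -> q != 0.
Proof. by case=> v [u []]. Qed.

Lemma quot_limD p q c p' q' c' : quot_lim p q c -> quot_lim p' q' c' ->
  quot_lim (p * q' + p' * q) (q * q') (c + c').
Proof.
move=> [v [u [q0 e u0 ev]]] [v' [u' [q'0 e' u'0 ev']]].
exists (v * u' + v' * u), (u * u'); split; rewrite ?hornerM ?mulf_neq0 //.
  have -> : (p * q' + p' * q) * (u * u') = p * u * (q' * u') + p' * u' * (q * u) by ring.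
  by rewrite e e'; ring.
by rewrite !hornerE ev ev' rmorphD /=; ring.
Qed.

Lemma quot_limM p q c p' q' c' : quot_lim p q c -> quot_lim p' q' c' ->
  quot_lim (p * p') (q * q') (c * c').
Proof.
move=> [v [u [q0 e u0 ev]]] [v' [u' [q'0 e' u'0 ev']]].
exists (v * v'), (u * u'); split; rewrite ?hornerM ?mulf_neq0 //.
  by rewrite mulrACA e e' mulrACA.
by rewrite ev ev' rmorphM /=; ring.
Qed.

Lemma quot_lim_num p q c : quot_lim p q c -> c != 0 -> p != 0.
Proof.
move=> [v [u [q0 e u0 ev]]] c0; apply: contraNneq c0 => p0.
have v0 : v = 0.
  by move/eqP: e; rewrite p0 mul0r eq_sym mulf_eq0 (negbTE q0) => /eqP.
by move/eqP: ev; rewrite v0 horner0 eq_sym mulf_eq0 (negbTE u0) orbF eq_complex => /andP[].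
Qed.

Lemma quot_limV p q c : quot_lim p q c -> c != 0 -> quot_lim q p c^-1.
Proof.
move=> l c0; have p0 := quot_lim_num l c0; case: l => [v [u [q0 e u0 ev]]].
exists u, v; split => //; rewrite ev.
  by rewrite mulf_neq0 // eq_complex /= negb_and c0.
by rewrite mulrA -rmorphM /= mulVf // mul1r.
Qed.

(* F tends to c at the base point along the branches of index k >= K. *)
Definition lim_at K (F : plane R -> R) (c : R) := exists p q,
  generic (fun u => F u * beval u q = beval u p) /\
  forall k, (K <= k)%N -> quot_lim (along k p) (along k q) c.

Lemma lim_at_ext K F G c : generic (fun u => F u = G u) ->
  lim_at K F c -> lim_at K G c.
Proof.
move=> FG [p [q [h l]]]; exists p, q; split=> //.
by apply: (generic2 FG h) => u ->.
Qed.

Lemma lim_at_le K K' F c : (K <= K')%N -> lim_at K F c -> lim_at K' F c.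
Proof.
move=> KK' [p [q [h l]]]; exists p, q; split=> // k /(leq_trans KK').
exact: l.
Qed.

Lemma lim_at_poly K p c : (forall k, (K <= k)%N -> (along k p).[rho] = c%:C%C) ->
  lim_at K (beval^~ p) c.
Proof.
move=> h; exists p, 1; split; first by apply: generic_true => u; rewrite beval1 mulr1.
move=> k /h e; exists (along k p), 1; split; rewrite ?rmorph1 ?oner_neq0 ?mul1r ?mulr1 //.
  by rewrite hornerE oner_neq0.
by rewrite e hornerE mulr1.
Qed.

Lemma lim_at_cst K c : lim_at K (fun=> c) c.
Proof.
apply: (@lim_at_ext K (beval^~ c%:P%:P)); first by apply: generic_true => u; rewrite beval_cst.
by apply: lim_at_poly => k _; rewrite along_cst hornerC.
Qed.

Lemma lim_atD K F G c d : lim_at K F c -> lim_at K G d ->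
  lim_at K (fun u => F u + G u) (c + d).
Proof.
move=> [p [q [h l]]] [p' [q' [h' l']]]; exists (p * q' + p' * q), (q * q'); split.
  by apply: (generic2 h h') => u e e'; rewrite bevalD !bevalM -e -e'; ring.
by move=> k Kk; rewrite rmorphD !rmorphM; apply: quot_limD; [exact: l|exact: l'].
Qed.

Lemma lim_atM K F G c d : lim_at K F c -> lim_at K G d ->
  lim_at K (fun u => F u * G u) (c * d).
Proof.
move=> [p [q [h l]]] [p' [q' [h' l']]]; exists (p * p'), (q * q'); split.
  by apply: (generic2 h h') => u e e'; rewrite !bevalM -e -e'; ring.
by move=> k Kk; rewrite !rmorphM; apply: quot_limM; [exact: l|exact: l'].
Qed.

Lemma along_neq0 k p : along k p != 0 -> p != 0.
Proof. by apply: contraNneq => ->; rewrite rmorph0. Qed.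

(** The numerator is nonzero along branch K, hence a nonzero polynomial, and generically F vanishes
    only where it does. *)
Lemma lim_at_neq0 K F c : lim_at K F c -> c != 0 -> generic (fun u => F u != 0).
Proof.
move=> [p [q [h l]]] c0.
have /generic_neq0 p0 : p != 0 by exact: along_neq0 (quot_lim_num (l K (leqnn _)) c0).
apply: (generic2 h p0) => u; have [->|//] := eqVneq (F u) 0.
by rewrite mul0r => <-; rewrite eqxx.
Qed.

Lemma lim_atV K F c : lim_at K F c -> c != 0 -> lim_at K (fun u => (F u)^-1) c^-1.
Proof.
move=> lF c0; have F0 := lim_at_neq0 lF c0.
case: lF => [p [q [h l]]]; exists q, p; split; last first.
  by move=> k Kk; apply: quot_limV => //; exact: l.
by apply: (generic2 h F0) => u <- Fu; rewrite mulrA mulVf // mul1r.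
Qed.

Lemma lim_at_sum (I : finType) K (F : I -> plane R -> R) c :
  (forall i, lim_at K (F i) (c i)) ->
  lim_at K (fun u => \sum_i F i u) (\sum_i c i).
Proof.
move=> h; elim: (index_enum I) => [|i s IH].
  rewrite big_nil; apply: lim_at_ext (lim_at_cst _ 0).
  by apply: generic_true => u; rewrite big_nil.
rewrite big_cons; apply: lim_at_ext (lim_atD (h i) IH).
by apply: generic_true => u; rewrite big_cons.
Qed.

Lemma lim_at_peval n K (f : plane R -> 'rV[R]_n) (a : 'rV[R]_n) p :
  (forall j, lim_at K (fun u => f u 0 j) (a 0 j)) ->
  lim_at K (fun u => peval p (f u)) (peval p a).
Proof.
move=> h; elim/mpoly_ring_ind: p => [c|i|p q hp hq|p q hp hq].
- rewrite pevalC; apply: lim_at_ext (lim_at_cst _ c).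
  by apply: generic_true => u; rewrite pevalC.
- rewrite pevalX; apply: lim_at_ext (h i).
  by apply: generic_true => u; rewrite pevalX.
- rewrite pevalD; apply: lim_at_ext (lim_atD hp hq).
  by apply: generic_true => u; rewrite pevalD.
- rewrite pevalM; apply: lim_at_ext (lim_atM hp hq).
  by apply: generic_true => u; rewrite pevalM.
Qed.

Lemma lim_at_frac K F c : lim_at K F c ->
  exists p q, q != 0 /\ generic (fun u => F u * beval u q = beval u p).
Proof.
move=> [p [q [h l]]]; exists p, q; split => //.
exact: along_neq0 (quot_lim_den (l K (leqnn _))).
Qed.

End Lim.
End Arcs.

(** * The functions with a limit form a valuation ring *)

Section Total.
Variables (R : realType) (b : bool).
Local Notation rho := ((b%:R : R)%:C%C).
Implicit Types p q : {poly {poly R}}.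

(** Both base points are roots of x (x - 1), so the branch vanishes there to order at least k. *)
Lemma branch_dvd m k : (m <= k)%N ->
  exists z, branch R k = ('X - rho%:P) ^+ m * z.
Proof.
move=> mk; have [z0 e0] : exists z0 : {poly R[i]}, 'X * ('X - 1) = ('X - rho%:P) * z0.
  rewrite rmorph_nat; case: (b); [exists 'X | exists ('X - 1)].
    by rewrite mulrC polyC1.
  by rewrite polyC0; congr (_ * _); rewrite subr0.
exists ('i%C *: (z0 ^+ m * ('X * ('X - 1)) ^+ (k - m))).
by rewrite /branch -scalerAr mulrA -exprMn -e0 -exprD subnKC.
Qed.

Lemma branch_neq0 k : branch R k != 0.
Proof.
rewrite /branch scale_poly_eq0 expf_eq0 mulf_eq0 polyX_eq0 -polyC1 polyXsubC_eq0.
by rewrite !andbF orbF eq_complex /= oner_eq0 andbF.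
Qed.

(** Here y ^ i is the exact power of y in p, and (x - b) ^ j the exact power of x - b in what is
    left at y = 0. The other terms contain a further y, negligible for large k. The coefficient c is
    real because p is. *)
Lemma along_lead p : p != 0 -> exists (i j : nat) (c : R) (K : nat), c != 0 /\
  forall k, (K <= k)%N -> exists u,
    along k p = branch R k ^+ i * ('X - rho%:P) ^+ j * u /\ u.[rho] = c%:C%C.
Proof.
move=> p0; have [i [q]] := multiplicity_XsubC p 0.
rewrite p0 subr0 /= => q0 ->; set q' := q.[0] in q0 *.
have [j [r]] := multiplicity_XsubC q' (b%:R).
rewrite /root in q0; rewrite q0 /= => r0 er.
have [s es] : exists s, q = q'%:P + s * 'X.
  have /factor_theorem[s] : root (q - q'%:P) 0 by rewrite /root !hornerE subrr.
  by rewrite subr0 => es; exists s; rewrite -es addrC subrK.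
(* From index [j.+1] on, the further factor y still vanishes at the base point after division by the
   j-th power. *)
exists i, j, r.[b%:R], j.+1; split => // k /branch_dvd[z ez].
exists (map_poly (real_complex R) r + ('X - rho%:P) * z * along k s); split.
  rewrite rmorphM rmorphXn /= alongX es rmorphD rmorphM /= alongC alongX er.
  rewrite rmorphM rmorphXn /= rmorphB /= map_polyX map_polyC /= {1}ez.
  rewrite [_ ^+ j.+1]exprS; move: (_ - _) (branch _ _) (map_poly _ _) (along k s) => A B C D.
  ring.
by rewrite !hornerE subrr !mul0r addr0 horner_map.
Qed.



Lemma quot_limI (p q g v u : {poly R[i]}) c : g != 0 -> u.[rho] != 0 ->
  v.[rho] = c%:C%C * u.[rho] -> p = g * v -> q = g * u -> quot_lim b p q c.
Proof.
move=> g0 u0 ev -> ->; exists v, u; split => //.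
  by rewrite mulf_neq0 //; apply: contraNneq u0 => ->; rewrite horner0.
by rewrite mulrAC.
Qed.

(** The pairs (i, j) of leading exponents are compared lexicographically; the quotient of the larger
    by the smaller converges. *)
Lemma quot_total p q : p != 0 -> q != 0 ->
  (exists (c : R) K, forall k, (K <= k)%N -> quot_lim b (along k q) (along k p) c) \/
  (exists (c : R) K, forall k, (K <= k)%N -> quot_lim b (along k p) (along k q) c).
Proof.
move=> /along_lead[i [j [c [K [c0 hp]]]]] /along_lead[i' [j' [c' [K' [c'0 hq]]]]].
pose lexle i j i' j' := (i < i')%N \/ i = i' /\ (j <= j')%N.
wlog le : p q i j c K c0 hp i' j' c' K' c'0 hq / lexle i j i' j'.
  move=> wl; case: (ltngtP i i') => ii'.
  - by apply: (wl p q i j c K _ _ i' j' c' K') => //; left.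
  - apply/or_comm.
    by apply: (wl q p i' j' c' K' _ _ i j c K) => //; left.
  case/orP: (leq_total j j') => jj'.
    by apply: (wl p q i j c K _ _ i' j' c' K') => //; right.
  apply/or_comm.
  by apply: (wl q p i' j' c' K' _ _ i j c K) => //; right.
have C0 x : x != 0 -> x%:C%C != 0 :> R[i] by rewrite eq_complex /= negb_and => ->.
have g0 k n m : branch R k ^+ n * ('X - rho%:P) ^+ m != 0.
  by rewrite mulf_neq0 // expf_neq0 ?branch_neq0 // polyXsubC_eq0.
left; case: le => [ii'|[ii' jj']].
  (* The numerator has an extra factor [branch R k], which for k > j outweighs the j-th power in the
     denominator: the limit is 0. *)
  exists 0, (maxn j.+1 (maxn K K')) => k.
  rewrite !geq_max => /andP[jk /andP[/hp[u [-> eu]] /hq[u' [-> eu']]]].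
  have [z ez] := branch_dvd jk.
  apply: (quot_limI (g0 k i j)
    (v := branch R k ^+ (i' - i.+1) * ('X - rho%:P) ^+ j' * ('X - rho%:P) * z * u')
    (u := u)) => //.
  - by rewrite eu C0.
  - by rewrite !hornerM hornerXsubC subrr mulr0 !mul0r.
  rewrite -{1}(subnKC ii') exprD exprSr {2}ez exprSr.
  move: (branch R k) ('X - _) => A B.
  ring.
rewrite -ii' in hq.
(* Equal exponents leave the ratio of the leading coefficients; otherwise a positive power of x - b
   remains. *)
exists (if j' == j then c' / c else 0), (maxn K K') => k.
rewrite !geq_max => /andP[/hp[u [-> eu]] /hq[u' [-> eu']]].
apply: (quot_limI (g0 k i j) (v := ('X - rho%:P) ^+ (j' - j) * u') (u := u)) => //.
- by rewrite eu C0.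
- rewrite hornerM horner_exp hornerXsubC subrr eu eu'; case: eqVneq => [->|ne].
    by rewrite subnn expr0 mul1r -rmorphM /= divfK.
  by rewrite expr0n subn_eq0 leqNgt ltn_neqAle jj' eq_sym ne /= !mul0r.
- by rewrite -{1}(subnKC jj') exprD !mulrA.
Qed.

Lemma quot_lim_trans (p q r : {poly R[i]}) c d :
  quot_lim b p q c -> quot_lim b q r d -> quot_lim b p r (c * d).
Proof.
move=> h h'; have q0 := quot_lim_den h; case: (quot_limM h h') => v [u [_ e u0 ev]].
exists v, u; split => //; first exact: quot_lim_den h'.
by apply: (mulfI q0); rewrite mulrA (mulrC q) e mulrA.
Qed.

(** An element of least valuation in a finite family. Zero entries have limit 0 relative to any
    nonzero one. *)
Lemma quot_lim_minimal (s : seq {poly {poly R}}) :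
  (exists2 p, p \in s & p != 0) ->
  exists2 p, p \in s & p != 0 /\ forall q, q \in s ->
    exists (c : R) K, forall k, (K <= k)%N -> quot_lim b (along k q) (along k p) c.
Proof.
have lim0 p : p != 0 -> exists (c : R) K, forall k, (K <= k)%N ->
    quot_lim b (along k 0) (along k p) c.
  move=> p0; have [c [K h]] : exists (c : R) K, forall k, (K <= k)%N ->
      quot_lim b (along k p) (along k p) c by case: (quot_total p0 p0).
  exists 0, K => k /h/quot_lim_den pk; exists 0, 1.
  by split; rewrite ?rmorph0 ?mul0r ?mulr0 ?horner0 ?hornerC ?oner_neq0.
elim: s => [[p]|q s IH [p]]; first by rewrite in_nil.
have [[m ms [m0 hm]] _|h] := pselect (exists2 p, p \in s & p != 0 /\
    forall q, q \in s -> exists (c : R) K, forall k, (K <= k)%N ->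
    quot_lim b (along k q) (along k p) c); last first.
  have s0 r : r \in s -> r = 0.
    by move=> rs; apply: contrapT => /eqP r0; apply: h; apply: IH; exists r.
  rewrite inE => /orP[/eqP -> q0|/s0 ->]; last by rewrite eqxx.
  exists q; rewrite ?mem_head //; split => // r; rewrite inE => /orP[/eqP ->|/s0 ->].
    by case: (quot_total q0 q0).
  exact: lim0.
have [->|q0] := eqVneq q 0.
  exists m; first by rewrite inE ms orbT.
  by split => // r; rewrite inE => /orP[/eqP ->|/hm //]; exact: lim0.
have [h|[c [K h]]] := quot_total m0 q0.
  exists m; first by rewrite inE ms orbT.
  by split => // r; rewrite inE => /orP[/eqP ->|/hm].
exists q; rewrite ?mem_head //; split => // r; rewrite inE => /orP[/eqP ->|].
  by case: (quot_total q0 q0).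
move=> /hm[c' [K' h']]; exists (c' * c), (maxn K K') => k.
rewrite geq_max => /andP[/h hk /h' hk']; exact: quot_lim_trans hk' hk.
Qed.

(* Dividing by F j gives the limit of (F 0 : ... : F r), hence a lift of the   *)
(* branches to a blowup.                                                      *)
Lemma lim_at_dominant r K (F : 'I_r -> plane R -> R) (a : 'I_r -> R) :
  (forall i, lim_at b K (F i) (a i)) -> generic (fun u => exists i, F i u != 0) ->
  exists j K' c, [/\ (K <= K')%N, generic (fun u => F j u != 0) &
    forall i, lim_at b K' (fun u => F i u / F j u) (c i)].
Proof.
move=> lF nz.
have frac i := lim_at_frac (lF i).
pose p i := projT1 (cid (frac i)); pose q i := projT1 (cid (projT2 (cid (frac i)))).
have q0 i : q i != 0 by exact: (projT2 (cid (projT2 (cid (frac i))))).1.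
have Fq i : generic (fun u => F i u * beval u (q i) = beval u (p i)).
  exact: (projT2 (cid (projT2 (cid (frac i))))).2.
(* Over the common denominator [Q], the ratios of the [F i] become ratios of the polynomials
   [P i]. *)
pose P i := p i * \prod_(l | l != i) q l; pose Q := \prod_l q l.
have Q0 : Q != 0 by apply/prodf_neq0.
have FQ i : generic (fun u => F i u * beval u Q = beval u (P i)).
  by apply: genericW (Fq i) => u e; rewrite /Q (bigD1 i) //= !bevalM mulrA e.
have gQ := generic_neq0 Q0.
have [m] : exists2 m, m \in [seq P i | i <- enum 'I_r] & m != 0 /\
    forall q, q \in [seq P i | i <- enum 'I_r] ->
    exists (c : R) K, forall k, (K <= k)%N -> quot_lim b (along k q) (along k m) c.
  apply: quot_lim_minimal; apply: contrapT => h.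
  have [u [[[i Fi] e] Qu]] := generic_ex (generic_and (generic_and nz (generic_all FQ)) gQ).
  have P0 : P i = 0.
    apply: contrapT => /eqP Pi; apply: h; exists (P i) => //.
    by apply: map_f; rewrite mem_enum.
  by move/eqP: (e i); rewrite P0 beval0 mulf_eq0 (negbTE Fi) (negbTE Qu).
move=> /mapP[j _ ->] [Pj hj].
have {}hj i : exists cK : R * nat, forall k, (cK.2 <= k)%N ->
    quot_lim b (along k (P i)) (along k (P j)) cK.1.
  have [|c [K' h]] := hj (P i); last by exists (c, K').
  by apply: map_f; rewrite mem_enum.
have [cK hcK] := choice hj.
have gF : generic (fun u => F j u != 0).
  apply: (generic2 (FQ j) (generic_neq0 Pj)) => u <-.
  by rewrite mulf_eq0 negb_or => /andP[].
exists j, (maxn K (\max_i (cK i).2)), (fun i => (cK i).1); split => //.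
  exact: leq_maxl.
move=> i; exists (P i), (P j); split; last first.
  move=> k; rewrite geq_max => /andP[_ hk]; apply: hcK.
  by apply: leq_trans hk; exact: leq_bigmax.
apply: (generic2 (generic_and gF (FQ j)) (FQ i)) => u [Fj <-] <-.
by rewrite mulrA divfK.
Qed.

End Total.

(** * Lifting the branches to multi-blowups *)

(** Two distinct limits would make F - F generically nonzero. *)
Lemma lim_at_unique (R : realType) b K (F : plane R -> R) c d :
  lim_at b K F c -> lim_at b K F d -> c = d.
Proof.
move=> Fc Fd; apply: contrapT => /eqP; rewrite -subr_eq0 => cd.
have l := lim_atD Fc (lim_atM (lim_at_cst b K (-1)) Fd).
rewrite mulN1r in l.
by have [u] := generic_ex (lim_at_neq0 l cd); rewrite mulN1r subrr eqxx.
Qed.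

(** Near x the function g is a quotient of polynomials with denominator nonzero at x, and [phi]
    generically stays in the domain of that quotient. *)
Lemma affine_lim (R : realType) n (A : set 'rV[R]_n) b K
    (phi : plane R -> affine A) (x : affine A) :
  (forall j, lim_at b K (fun u => val (phi u) 0 j) (val x 0 j)) ->
  forall V g, affine_open V -> V x -> affine_regular V g ->
  lim_at b K (g \o phi) (g x).
Proof.
move=> h V g [S ->] /= Vx rg.
have [s Ss sx] : exists2 s, S s & peval s (val x) != 0.
  apply: contrapT => h'; apply: Vx => s Ss; apply: contrapT => /eqP sx.
  by apply: h'; exists s.
have gs := lim_at_neq0 (lim_at_peval s h) sx.
have [p [q [qx e]]] := rg x Vx.
have gq := lim_at_neq0 (lim_at_peval q h) qx.
rewrite (e x Vx qx).
apply: lim_at_ext (lim_atM (lim_at_peval p h) (lim_atV (lim_at_peval q h) qx)).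
apply: (generic2 gs gq) => u su qu /=; rewrite e // => zu.
by have /eqP := zu s Ss; rewrite (negbTE su).
Qed.

Lemma peval_regular (R : realType) n (A : set 'rV[R]_n) (X : rspace R)
    (e : rmap X (affine A)) (p : {mpoly R[n]}) :
  zregular setT (fun x : X => peval p (val (e x))).
Proof.
apply: (rmap_regular e (V := setT) (g := fun z : affine A => peval p (val z))).
  exact: affine_openT.
by move=> z _; exists p, 1; split=> [|y _ _]; rewrite peval1 ?oner_neq0 ?divr1.
Qed.

Lemma proj_pointE (R : realType) r (v : 'rV[R]_r) i j :
  proj_point v 0 (mxvec_index i j) = (\sum_l v 0 l ^+ 2)^-1 * (v 0 i * v 0 j).
Proof. by rewrite /proj_point mxvecE !mxE big_ord1 !mxE. Qed.

Lemma peval_sum (R : realType) n (I : finType) (F : I -> {mpoly R[n]}) x :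
  peval (\sum_i F i) x = \sum_i peval (F i) x.
Proof. by rewrite /peval raddf_sum. Qed.

(** * The graph of (f_1 : ... : f_r) and its limit points *)

Section Graph.
Variables (R : realType) (n r : nat) (f : 'I_r -> {mpoly R[n]}).

Definition graph_point (x : 'rV[R]_n) : 'rV[R]_(n + r * r) :=
  row_mx x (proj_point (\row_i peval (f i) x)).

Lemma graph_pointE x i j :
  graph_point x 0 (rshift n (mxvec_index i j)) =
  (\sum_l peval (f l) x ^+ 2)^-1 * (peval (f i) x * peval (f j) x).
Proof.
rewrite /graph_point row_mxEr proj_pointE !mxE; congr (_^-1 * _).
by apply: eq_bigr => l _; rewrite mxE.
Qed.

Lemma sum_sqr_neq0 (c : 'I_r -> R) i : c i != 0 -> \sum_l c l ^+ 2 != 0.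
Proof.
apply: contra_neq => /psumr_eq0P h; apply/eqP; rewrite -sqrf_eq0; apply/eqP.
by apply: h => // l _; exact: sqr_ge0.
Qed.

(** The projector coordinates have the common denominator given by the sum of the squares of the
    [f l], so a power of it clears denominators. This turns open conditions on the blowup into open
    conditions below. *)
Lemma graph_homogenize (s : {mpoly R[n + r * r]}) :
  exists N t, forall x, (exists i, peval (f i) x != 0) ->
    peval t x = (\sum_l peval (f l) x ^+ 2) ^+ N * peval s (graph_point x).
Proof.
pose D : {mpoly R[n]} := \sum_l f l ^+ 2.
have DE x : peval D x = \sum_l peval (f l) x ^+ 2.
  by rewrite peval_sum; apply: eq_bigr => l _; rewrite !expr2 pevalM.
have DX N x : peval (D ^+ N) x = (\sum_l peval (f l) x ^+ 2) ^+ N.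
  by rewrite -DE /peval rmorphXn.
elim/mpoly_ring_ind: s => [c|j|s t [N [p hp]] [M [q hq]]|s t [N [p hp]] [M [q hq]]].
- by exists 0%N, c%:MP => x _; rewrite !pevalC expr0 mul1r.
- case: (split_ordP j) => {j} j ->.
    by exists 0%N, 'X_j => x _; rewrite !pevalX row_mxEl expr0 mul1r.
  case/mxvec_indexP: j => i j; exists 1%N, (f i * f j) => x [l xl].
  rewrite pevalM pevalX graph_pointE expr1 mulrA divff ?mul1r //.
  exact: (@sum_sqr_neq0 (fun i => peval (f i) x) l).
- exists (N + M)%N, (D ^+ M * p + D ^+ N * q) => x xl.
  by rewrite !(pevalD, pevalM) hp // hq // !DX exprD; ring.
- exists (N + M)%N, (p * q) => x xl.
  by rewrite !pevalM hp // hq // exprD; ring.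
Qed.

(** The projector does not change when all [f i] are divided by the dominant [f j]. The ratios
    converge to [c i] with [c j] = 1, and the sum of their squares is nonzero because the limits are
    real. *)
Lemma graph_lim b K (phi : plane R -> 'rV[R]_n) (a : 'rV[R]_n) :
  (forall p, lim_at b K (fun u => peval p (phi u)) (peval p a)) ->
  generic (fun u => exists i, peval (f i) (phi u) != 0) ->
  exists K' w, [/\ (K <= K')%N, lsubmx w = a &
    forall j, lim_at b K' (fun u => graph_point (phi u) 0 j) (w 0 j)].
Proof.
move=> h nz; have [j [K' [c [KK' Fj lc]]]] := lim_at_dominant (fun i => h (f i)) nz.
have cj : c j = 1.
  apply: lim_at_unique (lc j) _; apply: lim_at_ext (lim_at_cst b K' 1).
  by apply: genericW Fj => u Fju; rewrite divff.
have c0 : \sum_l c l ^+ 2 != 0 by rewrite (@sum_sqr_neq0 _ j) // cj oner_neq0.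
pose w : 'rV[R]_(n + r * r) := row_mx a (proj_point (\row_i c i)).
exists K', w; rewrite row_mxKl; split => // l.
case: (split_ordP l) => {l} l ->.
  have := lim_at_le KK' (h 'X_l); rewrite pevalX row_mxEl; apply: lim_at_ext.
  by apply: generic_true => u; rewrite pevalX row_mxEl.
case/mxvec_indexP: l => i l.
rewrite row_mxEr proj_pointE !mxE.
under eq_bigr do rewrite mxE.
have lsq : lim_at b K' (fun u => \sum_l (peval (f l) (phi u) / peval (f j) (phi u)) ^+ 2)
    (\sum_l c l ^+ 2).
  by apply: lim_at_sum => m; apply: lim_atM.
apply: lim_at_ext (lim_atM (lim_atV lsq c0) (lim_atM (lc i) (lc l))).
apply: genericW Fj => u Fju; rewrite graph_pointE.
under eq_bigr do rewrite expr_div_n.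
rewrite -mulr_suml invfM invrK; move: (\sum_i _)^-1 => S.
by field.
Qed.

End Graph.

Section Lift.
Variable R : realType.

(* sigma is a rational section of a; the branches of large index lift to X,   *)
(* where they pass through real points over (0, 0) and (1, 0).                *)
Definition lifts_branches (X : rspace R) (a : rmap X (plane R))
    (sigma : plane R -> X) (K : nat) :=
  [/\ generic (fun u => a (sigma u) = u),
    forall V : set X, zopen V -> V !=set0 -> generic (fun u => V (sigma u)) &
    forall b : bool, exists x : X, val (a x) = b%:R *: delta_mx 0 0 /\
      forall (V : set X) g, zopen V -> V x -> zregular V g ->
        lim_at b K (g \o sigma) (g x)].

(** From index 1 on, the branches pass through both base points. *)
Lemma lifts_branches_id : lifts_branches (rmap_id (plane R)) id 1.
Proof.
split; first exact: generic_true.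
  move=> _ [S ->] [x Sx].
  have [s Ss sx] : exists2 s, S s & peval s (val x) != 0.
    apply: contrapT => h'; apply: Sx => s Ss; apply: contrapT => /eqP sx.
    by apply: h'; exists s.
  have [p hp] := beval_mpoly s; exists p.
    by apply: contraNneq sx => p0; rewrite -hp p0 beval0.
  by move=> u pu zu; move: pu; rewrite hp zu ?eqxx.
move=> b; pose v : 'rV[R]_2 := b%:R *: delta_mx 0 0.
have vT : v \in [set: 'rV[R]_2] by rewrite inE.
exists (SigSub vT); split => // V g; apply: affine_lim => j.
have [->|j0] := eqVneq j 0.
  apply: (@lim_at_ext R b 1 (fun u => beval u 'X%:P)).
    by apply: generic_true => u; rewrite beval_x.
  apply: lim_at_poly => k _; rewrite alongC map_polyX hornerX.
  by rewrite !mxE !eqxx mulr1.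
have -> : j = 1 by case: j j0 => [[|[|//]] hi] // _; exact: val_inj.
apply: (@lim_at_ext R b 1 (fun u => beval u 'X)).
  by apply: generic_true => u; rewrite beval_y.
apply: lim_at_poly => k k0; rewrite alongX /= !mxE /= mulr0.
have [z ->] := branch_dvd R b k0.
by rewrite expr1 hornerM hornerXsubC subrr mul0r.
Qed.

(** The section [sigma] generically avoids the centre, so it lifts by the graph; the limit points of
    the lift lie in the closure of the graph, that is, in the blowup. *)
Lemma lifts_branches_blowup (X Y : rspace R) (a : rmap X (plane R))
    (pi : rmap Y X) sigma K :
  lifts_branches a sigma K -> is_blowup pi ->
  exists sigma' K', lifts_branches (rmap_comp a pi) sigma' K'.
Proof.
move=> [sec dense pts] [n [A [Z [r [f [e [e' []]]]]]]].
move=> [_ [S algZ] ZA] [_ dZ [fZ genf] [[k [ek ke]] [k' [ek' ke']]] epi].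
have AX (x : X) : A (val (e x)) by apply: set_valP.
have Zf z : A z -> (forall i, peval (f i) z = 0) -> Z z.
  move=> Az fz; rewrite algZ => p Sp.
  have [|c ->] // := genf p; first by move=> y; rewrite algZ; exact.
  by apply: big1 => i _; rewrite fz mulr0.
pose coord u := val (e (sigma u)).
have gf : generic (fun u => exists i, peval (f i) (coord u) != 0).
  pose T := [set p | exists i, p = f i].
  pose W := e @^-1` [set z | ~ zeros T (val z)].
  have oW : zopen W by apply: (rmap_open e); exists T.
  have [w Ww] : W !=set0.
    (* If all [f i] vanished on A, then A \ Z and its closure would be empty, but the closure
       contains the image of x. *)
    apply: contrapT => W0; have [x _] := pts true.
    suff /(_ 1) : zclosure (A `\` Z) (val (e x)).
      rewrite peval1 => /(_ _)/eqP; rewrite oner_eq0 => h; suff: false by [].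
      apply: h => y [Ay Zy]; case: Zy; apply: Zf => // i.
      have yA : y \in A by rewrite inE.
      apply: contrapT => fy; apply: W0; exists (k (SigSub yA)).
      rewrite /W /= ke => h'; apply: fy; apply: h'; by exists i.
    exact: dZ.
  apply: genericW (dense W oW (ex_intro _ w Ww)) => u Wu.
  apply: contrapT => h; apply: Wu => _ [i ->]; apply: contrapT => /eqP fi.
  by apply: h; exists i.
pose gam u := graph_point f (coord u).
have gamY : generic (fun u => blowup_set A Z f (gam u)).
  apply: genericW gf => u [i fi] p; apply; exists (coord u) => //.
  split; first exact: AX.
  by move=> Zu; move: fi; rewrite fZ ?eqxx.
have [x xP] := choice pts.
have coordl b p : lim_at b K (fun u => peval p (coord u)) (peval p (val (e (x b)))).
  have [_ h] := xP b.
  exact: (h setT _ (zopenT X) I (peval_regular e p)).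
have /choice[Kw wP] b : exists Kw : nat * 'rV[R]_(n + r * r),
    [/\ (K <= Kw.1)%N, lsubmx Kw.2 = val (e (x b)) &
    forall j, lim_at b Kw.1 (fun u => gam u 0 j) (Kw.2 0 j)].
  by have [K' [w h]] := graph_lim (coordl b) gf; exists (K', w).
pose K' := maxn (Kw false).1 (Kw true).1.
have liml b j : lim_at b K' (fun u => gam u 0 j) ((Kw b).2 0 j).
  have [_ _ h] := wP b; apply: lim_at_le (h j).
  by case: (b); rewrite ?leq_maxl ?leq_maxr.
(* A polynomial vanishing on the graph vanishes at [gam u] for generic u, so its limit is 0. *)
have wY b : (Kw b).2 \in blowup_set A Z f.
  rewrite inE => p hp; have l := lim_at_peval p (liml b).
  apply: lim_at_unique l _; apply: lim_at_ext (lim_at_cst b K' 0).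
  by apply: genericW gf => u [i fi]; rewrite hp //; exists (coord u) => //;
    split; [exact: AX|move=> Zu; move: fi; rewrite fZ ?eqxx].
pose pY b : affine (blowup_set A Z f) := SigSub (wY b).
(* The point [pY false] is only a default value off a generic set. *)
pose sigma' u : Y := if pselect (blowup_set A Z f (gam u)) is left h
  then k' (SigSub (mem_set h)) else k' (pY false).
have e'sigma' : generic (fun u => val (e' (sigma' u)) = gam u).
  apply: genericW gamY => u Yu; rewrite /sigma'; case: pselect => // h.
  by rewrite ke'.
have eI x1 x2 : val (e x1) = val (e x2) -> x1 = x2.
  by move=> /val_inj /(can_inj ek).
exists sigma', K'; split.
- apply: (generic2 e'sigma' sec) => u h1 h2 /=.
  rewrite (_ : pi (sigma' u) = sigma u) //; apply: eI.
  by rewrite -epi h1 row_mxKl.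
- move=> V oV [y Vy].
  have [S' eS] := rmap_open k' oV.
  have inV z : V (k' z) <-> ~ zeros S' (val z) by move/seteqP: eS => [h1 h2]; split; [exact: h1|exact: h2].
  have [s Ss sy] : exists2 s, S' s & peval s (val (e' y)) != 0.
    apply: contrapT => h'; have /inV : V (k' (e' y)) by rewrite ek'.
    apply => s Ss; apply: contrapT => /eqP sx.
    by apply: h'; exists s.
  (* The blowup is the closure of the graph over A \ Z, so [s] cannot vanish on that whole graph. *)
  have [z [[Az Zz] sz]] : exists z, (A `\` Z) z /\ peval s (graph_point f z) != 0.
    apply: contrapT => h; move/eqP: sy; apply.
    have hz := set_valP (e' y); apply: (hz s) => _ [z Az <-].
    by apply: contrapT => /eqP sz; apply: h; exists z.
  have [N [t ht]] := graph_homogenize f s.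
  have fz : exists i, peval (f i) z != 0.
    apply: contrapT => h; apply: Zz; apply: Zf => // i.
    by apply: contrapT => /eqP fi; apply: h; exists i.
  have zA : z \in A by rewrite inE.
  pose W := e @^-1` [set z | ~ zeros [set t] (val z)].
  have oW : zopen W by apply: (rmap_open e); exists [set t].
  have W0 : W !=set0.
    exists (k (SigSub zA)); rewrite /W /= ke => /(_ t erefl) /=.
    rewrite ht // => /eqP; rewrite mulf_eq0 (negbTE sz) orbF expf_eq0.
    by case: fz => i fi; rewrite (negbTE (sum_sqr_neq0 fi)) andbF.
  apply: (generic2 (generic_and (dense W oW W0) gf) e'sigma') => u [Wu fu] eu.
  rewrite -(ek' (sigma' u)); apply/inV; rewrite eu => /(_ s Ss) su.
  by apply: Wu => _ ->; rewrite ht // su mulr0.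
move=> b; exists (k' (pY b)); split=> [|V g oV Vy rg].
  have [<- _] := xP b; congr (val (a _)); apply: eI.
  by rewrite -epi ke'; have [_ <- _] := wP b.
have ll : forall j, lim_at b K' (fun u => val (e' (sigma' u)) 0 j) (val (pY b) 0 j).
  by move=> j; apply: lim_at_ext (liml b j); apply: genericW e'sigma' => u ->.
have := affine_lim (phi := e' \o sigma') ll (rmap_open k' oV) Vy (rmap_regular k' oV rg).
by apply: lim_at_ext; apply: generic_true => u /=; rewrite ek'.
Qed.

Lemma multi_blowup_lifts (X : rspace R) (a : rmap X (plane R)) :
  multi_blowup a -> exists sigma K, lifts_branches a sigma K.
Proof.
elim=> [|{}X Y {}a pi _ [sigma [K la]] bpi].
  by exists id, 1%N; exact: lifts_branches_id.
exact: lifts_branches_blowup la bpi.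
Qed.

End Lift.

(** * Local triviality *)

Section HomTheory.
Variables (R : realType) (X : rspace R).

Lemma hom0 (U : opens X) (F G : omod X) (phi : forall V, F V -> G V) (V : opens X) :
  is_hom U phi -> V `<=` U -> phi V 0 = 0.
Proof.
by move=> [hD _ _] VU; apply: (addrI (phi V 0)); rewrite -hD // !addr0.
Qed.

Section DsumMap.
Variables (I : Type) (F G : I -> omod X) (U : opens X).
Variables (phi : forall i V, F i V -> G i V) (hom : forall i, is_hom U (@phi i)).

Lemma dsum_map_subproof (V : opens X) (s : dsum F V) : V `<=` U ->
  dsum_local (fun i => phi (dsum_fun s i)).
Proof.
move=> VU x /(dsum_loc s)[W [WV [Wx fW]]]; exists W, WV; split => //.
apply: sub_finite_set fW => i /= h e; apply: h.
by have [_ _ hR] := hom i; rewrite -hR // e (hom0 (hom i)) //; exact: subset_trans WV VU.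
Qed.

(** Outside U the maps [phi i] need not preserve 0, hence not local finiteness; the value there is 0
    by default. *)
Definition dsum_map (V : opens X) (s : dsum F V) : dsum G V :=
  if pselect (V `<=` U) is left VU then mkdsum (dsum_map_subproof s VU) else 0.

Lemma dsum_mapE (V : opens X) (s : dsum F V) i : V `<=` U ->
  dsum_fun (dsum_map s) i = phi (dsum_fun s i).
Proof. by rewrite /dsum_map; case: pselect. Qed.

Lemma dsum_map_hom : is_hom U dsum_map.
Proof.
split=> [V s t VU|V a s VU|V W h s VU]; apply: dsum_eqP => i;
  have [hD hZ hR] := hom i.
- by rewrite !dsum_mapE // hD // -!dsum_mapE.
- by rewrite !dsum_mapE // hZ // -!dsum_mapE.
- by rewrite !dsum_mapE ?hR // -?dsum_mapE //; exact: subset_trans h VU.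
Qed.
End DsumMap.

Lemma dsum_isomorphic (I : Type) (F G : I -> omod X) (U : opens X) :
  (forall i, isomorphic_on U (F i) (G i)) -> isomorphic_on U (dsum F) (dsum G).
Proof.
move=> iso.
pose phi i := projT1 (cid (iso i)); pose psi i := projT1 (cid (projT2 (cid (iso i)))).
have isoP i : [/\ is_hom U (phi i), is_hom U (psi i) &
    forall V : opens X, V `<=` U ->
      cancel (phi i V) (psi i V) /\ cancel (psi i V) (phi i V)].
  exact: (projT2 (cid (projT2 (cid (iso i))))).
have hphi i : is_hom U (phi i) by have [] := isoP i.
have hpsi i : is_hom U (psi i) by have [] := isoP i.
exists (dsum_map hphi), (dsum_map hpsi); split.
- exact: dsum_map_hom.
- exact: dsum_map_hom.
move=> V VU; split=> s; apply: dsum_eqP => i; rewrite !dsum_mapE //;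
  have [_ _ /(_ V VU)[c1 c2]] := isoP i; [exact: c1 | exact: c2].
Qed.

(** A free sheaf is the cokernel of the zero map from the free sheaf on an empty basis. *)
Lemma isomorphic_cokernel (I : Type) (F : omod X) (U : opens X) :
  isomorphic_on U F (free_sheaf X I) ->
  exists (I0 J : Type)
    (phi : forall V, free_sheaf X I0 V -> free_sheaf X J V)
    (psi : forall V, free_sheaf X J V -> F V), is_cokernel U phi psi.
Proof.
move=> [f [g [hf hg fg]]].
exists void, I, (fun V _ => 0), g; split => //.
- by split=> *; rewrite ?addr0 ?scaler0 ?res0.
- move=> V t x VU Vx; exists V, (@subset_refl _ _), (f V t); split => //.
  by rewrite res_id; have [c1 _] := fg V VU; rewrite c1.
move=> V s VU; split=> [e x Vx|h].
  exists V, (@subset_refl _ _), 0; split => //; rewrite res_id.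
  by have [_ c2] := fg V VU; rewrite -(c2 s) e (hom0 hf).
suff e0 : s = 0 by rewrite e0 (hom0 hg).
(* The hypothesis says that s vanishes locally; separation gives s = 0. *)
pose D := [set W : opens X | exists h : W `<=` V, res h s = 0].
apply: (sheaf_sep (D := D)) => [W [] //|x /h[W [WV [r [Wx e]]]]|W k [k' e]].
  by exists W => //; exists WV.
by rewrite res0 -[RHS]e; congr (res _ _); exact: Prop_irrelevance.
Qed.

End HomTheory.

(** * The sheaves F_(k,l) on the two charts *)

Section Frames.
Variable R : realType.

Definition Pkl_poly (k l : nat) : {poly {poly R}} :=
  ('X ^+ (2 * k) * ('X - 1) ^+ (2 * l))%:P + 'X ^+ 2.

Lemma beval_Pkl k l u : beval u (Pkl_poly k l) = Pkl k l u.
Proof. by rewrite /beval /Pkl !(hornerE, horner_exp). Qed.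

(** Both terms are squares, so a real zero needs y = 0 and x = 0 or x = 1. *)
Lemma Pkl_neq0 k l (u : plane R) : oset (U1 R) u -> oset (U2 R) u -> Pkl k l u != 0.
Proof.
rewrite /= /Pkl => u1 u2; set x := val u 0 0; set y := val u 0 1.
apply/eqP => e.
have : (x ^+ (2 * k) * (x - 1) ^+ (2 * l) == 0) && (y ^+ 2 == 0).
  rewrite -paddr_eq0 ?sqr_ge0 ?e ?eqxx //.
  by rewrite !exprM mulr_ge0 // exprn_ge0 // sqr_ge0.
rewrite mulf_eq0 !expf_eq0 /= subr_eq0 => /andP[xx /eqP y0].
have eu (c : 'rV[R]_2) : c 0 0 = x -> c 0 1 = 0 -> val u = c.
  move=> cx cy; apply/rowP => j.
  have [->//|j0] := eqVneq j 0.
  have -> : j = 1 by case: j j0 => [[|[|//]] hi] // _; exact: val_inj.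
  by rewrite cy.
have {xx} [x0|x1] : x = 0 \/ x = 1.
  by case/orP: xx => /andP[_ /eqP]; [left | right].
- by case/eqP: u1; apply: eu; rewrite mxE.
- by case/eqP: u2; apply: eu; rewrite mxE ?eqxx.
Qed.

Definition Pkl_mpoly (k l : nat) : {mpoly R[2]} :=
  'X_0 ^+ (2 * k) * ('X_0 - 1) ^+ (2 * l) + 'X_1 ^+ 2.

Lemma peval_Pkl k l (u : plane R) : peval (Pkl_mpoly k l) (val u) = Pkl k l u.
Proof.
rewrite /Pkl_mpoly pevalD pevalM /peval !rmorphXn /= -!/(peval _ _).
by rewrite pevalB !pevalX peval1.
Qed.

Lemma Pkl_regular k l (V : opens (plane R)) : zregular V (Pkl k l).
Proof.
move=> x _; exists (Pkl_mpoly k l), 1; rewrite peval1 oner_neq0; split => // y _ _.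
by rewrite peval_Pkl peval1 divr1.
Qed.

Lemma PklV_regular k l (V : opens (plane R)) : V `<=` oset (U1 R) `&` oset (U2 R) ->
  zregular V (fun u => (Pkl k l u)^-1).
Proof.
move=> hV x Vx; exists 1, (Pkl_mpoly k l); rewrite peval_Pkl.
split; first by case: (hV x Vx); exact: Pkl_neq0.
by move=> y _ _; rewrite peval_Pkl peval1 div1r.
Qed.

(** The chart [Ub b] misses the base point of Boolean b and contains the other one. *)
Definition Ub (b : bool) : opens (plane R) := if b then U2 R else U1 R.

Definition fkl_comp (b : bool) k l (V : opens (plane R)) (s : Fkl R k l V) : plane R -> R :=
  if b then (fkl_pair s).2 : plane R -> R else (fkl_pair s).1.

Section FklComp.
Variables (b : bool) (k l : nat).
Implicit Types V W : opens (plane R).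

Lemma fkl_comp_regular V (s : Fkl R k l V) : zregular (openI (Ub b) V) (fkl_comp b s).
Proof. by rewrite /fkl_comp /Ub; case: (b); exact: regfun_reg. Qed.

Lemma fkl_comp_out V (s : Fkl R k l V) y : ~ oset (Ub b) y -> fkl_comp b s y = 0.
Proof. by rewrite /fkl_comp /Ub; case: (b) => h; rewrite regfun_out // => -[]. Qed.

Lemma fkl_compD V (s t : Fkl R k l V) y :
  fkl_comp b (s + t) y = fkl_comp b s y + fkl_comp b t y.
Proof. by rewrite /fkl_comp; case: (b). Qed.

Lemma fkl_compZ V (a : regfun V) (s : Fkl R k l V) y : oset V y ->
  fkl_comp b (a *: s) y = a y * fkl_comp b s y.
Proof.
move=> Vy; have [by_|nby] := pselect (oset (Ub b) y); last by rewrite !fkl_comp_out ?mulr0.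
by move: by_; rewrite /fkl_comp /Ub; case: (b) => h; rewrite [LHS]regfun_mulE rrestrE.
Qed.

Lemma fkl_comp_res V W (h : W `<=` V) (s : Fkl R k l V) y : oset W y ->
  fkl_comp b (res h s) y = fkl_comp b s y.
Proof.
move=> Wy; have [by_|nby] := pselect (oset (Ub b) y); last by rewrite !fkl_comp_out.
by move: by_; rewrite /fkl_comp /Ub; case: (b) => h'; rewrite [LHS]rrestrE.
Qed.

(** Inside one chart the other component lives on a part of U1 and U2 in common, where P is
    invertible and determines it. *)
Lemma fkl_comp_inj V (s t : Fkl R k l V) : V `<=` Ub b ->
  (forall y, oset V y -> fkl_comp b s y = fkl_comp b t y) -> s = t.
Proof.
move=> VU e; apply: fkl_eqP; apply: regfun_eqP => y [hy Vy].
  move: (VU y Vy) (e y Vy); rewrite /Ub /fkl_comp; case: (b) => // h2 e2.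
  apply: (mulfI (Pkl_neq0 k l hy h2)).
  by rewrite !fkl_glue_eq.
move: (VU y Vy) (e y Vy); rewrite /Ub /fkl_comp; case: (b) => // h2 e2.
by rewrite -!fkl_glue_eq // e2.
Qed.

(** The missing component is g / P or P g. *)
Lemma fkl_comp_surj V (g : regfun V) : V `<=` Ub b ->
  exists s : Fkl R k l V, forall y, oset V y -> fkl_comp b s y = g y.
Proof.
move=> VU; move: (VU); rewrite /Ub /fkl_comp; case: (b) => hV.
  have r1 : zregular (openI (U1 R) V) (fun y => (Pkl k l y)^-1 * g y).
    apply: zregularM (opensP _) _ _; first by apply: PklV_regular => y [? /hV].
    by apply: zregular_sub (regfun_reg g); [exact: opensP|exact: opensP|move=> y []].
  have r2 : zregular (openI (U2 R) V) g.
    by apply: zregular_sub (regfun_reg g); [exact: opensP|exact: opensP|move=> y []].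
  have h : (mkregfun r1, mkregfun r2) \in @fkl_pred R k l V.
    apply/asboolP => y [[h1 h2] Vy]; rewrite [_.1]/= [_.2]/= !mkregfunE //.
    by rewrite mulrA mulfV ?mul1r // Pkl_neq0.
  exists (FklSec h) => y Vy; rewrite [_.2]/= mkregfunE //; split => //; exact: hV.
have r1 : zregular (openI (U1 R) V) g.
  by apply: zregular_sub (regfun_reg g); [exact: opensP|exact: opensP|move=> y []].
have r2 : zregular (openI (U2 R) V) (fun y => Pkl k l y * g y).
  apply: zregularM (opensP _) _ _; first exact: Pkl_regular.
  by apply: zregular_sub (regfun_reg g); [exact: opensP|exact: opensP|move=> y []].
have h : (mkregfun r1, mkregfun r2) \in @fkl_pred R k l V.
  by apply/asboolP => y [[h1 h2] Vy]; rewrite [_.1]/= [_.2]/= !mkregfunE.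
exists (FklSec h) => y Vy; rewrite [_.1]/= mkregfunE //; split => //; exact: hV.
Qed.

Lemma Fkl_trivial : isomorphic_on (Ub b) (Fkl R k l) (struct_sheaf (plane R)).
Proof.
have reg V (s : Fkl R k l V) : V `<=` Ub b -> zregular V (fkl_comp b s).
  move=> VU; apply: zregular_sub (fkl_comp_regular s); [exact: opensP|exact: opensP|].
  by move=> y Vy; split => //; exact: VU.
pose phi V (s : Fkl R k l V) : struct_sheaf (plane R) V :=
  if pselect (V `<=` Ub b) is left h then mkregfun (reg V s h) else 0.
pose psi V (g : struct_sheaf (plane R) V) : Fkl R k l V :=
  if pselect (V `<=` Ub b) is left h then projT1 (cid (fkl_comp_surj g h)) else 0.
have phiE V (s : Fkl R k l V) y : V `<=` Ub b -> oset V y ->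
    (phi V s : regfun V) y = fkl_comp b s y.
  by move=> VU Vy; rewrite /phi; case: pselect => // h; rewrite mkregfunE.
have psiE V (g : regfun V) y : V `<=` Ub b -> oset V y ->
    fkl_comp b (psi V g) y = g y.
  by move=> VU Vy; rewrite /psi; case: pselect => // h; case: cid => s /=; exact.
exists phi, psi; split.
- split=> [V s t VU|V a s VU|V W h s VU]; apply: regfun_eqP => y Vy.
  + by rewrite regfunD_val !phiE // fkl_compD.
  + by rewrite regfun_mulE !phiE // fkl_compZ.
  + by rewrite rrestrE // !phiE ?fkl_comp_res //; [exact: h | exact: subset_trans h VU].
- split=> [V s t VU|V a s VU|V W h s VU].
  + by apply: fkl_comp_inj => // y Vy; rewrite fkl_compD !psiE.
  + by apply: fkl_comp_inj => // y Vy; rewrite fkl_compZ // !psiE // regfun_mulE.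
  + have WU := subset_trans h VU; apply: fkl_comp_inj => // y Vy.
    by rewrite fkl_comp_res // !psiE ?rrestrE //; exact: h.
move=> V VU; split=> s; [apply: fkl_comp_inj|apply: regfun_eqP] => // y Vy.
  by rewrite psiE // phiE.
by rewrite phiE // psiE.
Qed.

End FklComp.

Lemma Ub_cover (x : plane R) : exists b, oset (Ub b) x.
Proof.
have [e|ne] := eqVneq (val x) (c1 R); last by exists false.
exists true; rewrite /= e; apply/eqP => /rowP/(_ 0)/eqP.
by rewrite !mxE eq_sym oner_eq0.
Qed.

Lemma Fsum_trivial b : isomorphic_on (Ub b) (Fsum R) (free_sheaf (plane R) nat).
Proof. by apply: dsum_isomorphic => k; exact: Fkl_trivial. Qed.

Lemma Fsum_quasi_coherent : quasi_coherent (Fsum R).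
Proof.
exists 2%N, (fun i : 'I_2 => Ub (i == 0)); split.
  move=> x; have [[] hx] := Ub_cover x; [by exists 0 | by exists 1].
by move=> i; exact: isomorphic_cokernel (Fsum_trivial _).
Qed.

Lemma Fsum_locally_free : locally_free_infinite (Fsum R).
Proof.
move=> x; have [b hb] := Ub_cover x; exists (Ub b), nat; split => //.
  exact: infinite_nat.
exact: Fsum_trivial.
Qed.

End Frames.

(** * Sections of the pullback *)

Section LocalValue.
Variables (R : realType) (X : rspace R) (x : X).

Definition local_val (a : local_ring x) : R := (pg_sec (repr a) : regfun _) x.

Lemma local_valE (U : opens X) (Ux : oset U x) (f : regfun U) :
  local_val (rgerm Ux f) = f x.
Proof.
rewrite /local_val.
have : mkgerm (pg_mem (repr (rgerm Ux f))) (pg_sec (repr (rgerm Ux f)))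
   = rgerm Ux f by exact: repr_mkgerm.
case: (repr _) => A Ax a /= /mkgerm_eq[W [WA [WU [Wx e]]]].
have e' : rrestr WA a = rrestr WU f := e.
by have := congr1 (fun k : regfun W => k x) e'; rewrite !rrestrE.
Qed.

Lemma local_valD a b : local_val (a + b) = local_val a + local_val b.
Proof.
have [U [Ux [f [g [-> ->]]]]] := rgerm_sP a (b : stalk (struct_sheaf X) x).
by rewrite [X in local_val X](rgermD Ux f g) !local_valE.
Qed.

Lemma local_valM a b : local_val (a * b) = local_val a * local_val b.
Proof.
have [U [Ux [f [g [-> ->]]]]] := rgerm_sP a (b : stalk (struct_sheaf X) x).
by rewrite [X in local_val X](rgermM Ux f g) !local_valE regfun_mulE.
Qed.

Lemma local_val_fgerm (U : opens X) (f : regfun U) : oset U x ->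
  local_val (fgerm x f) = f x.
Proof. by move=> Ux; rewrite /fgerm (germE (F := struct_sheaf X) Ux) local_valE. Qed.

End LocalValue.

Lemma local_val_pull (R : realType) (X Y : rspace R) (f : rmap X Y) (x : X)
    (a : local_ring (f x)) : local_val (local_pull f x a) = local_val a.
Proof.
have [U [Ux [g ->]]] := rgermP a.
by rewrite local_pullE !local_valE regfun_pullE.
Qed.

(* A linear form on the fibre of F at x, as a compatible family of maps on    *)
(* sections; its values on the opens that do not contain x are irrelevant.    *)
Record fibre_form (R : realType) (X : rspace R) (F : omod X) (x : X) := FibreForm {
  form_fun : forall U : opens X, F U -> R;
  formD : forall (U : opens X) (s t : F U),
    form_fun (s + t) = form_fun s + form_fun t;
  formZ : forall (U : opens X) (a : regfun U) (s : F U), oset U x ->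
    form_fun (a *: s) = a x * form_fun s;
  form_res : forall (U V : opens X) (h : V `<=` U) (s : F U), oset V x ->
    form_fun (res h s) = form_fun s }.

Section StalkForm.
Variables (R : realType) (X : rspace R) (F : omod X) (x : X) (phi : fibre_form F x).

Definition stalk_form (t : stalk F x) : R := form_fun phi (pg_sec (repr t)).

Lemma stalk_formE (U : opens X) (Ux : oset U x) (s : F U) :
  stalk_form (mkgerm Ux s) = form_fun phi s.
Proof.
rewrite /stalk_form; have := repr_mkgerm (mkgerm Ux s).
case: (repr _) => A Ax a /= /mkgerm_eq[W [WA [WU [Wx e]]]].
by rewrite -(form_res phi WA) // e form_res.
Qed.

Lemma stalk_formD s t : stalk_form (s + t) = stalk_form s + stalk_form t.
Proof.
by have [U [Ux [a [b [-> ->]]]]] := mkgerm2P s t; rewrite mkgermDE !stalk_formE formD.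
Qed.

Lemma stalk_formZ (a : local_ring x) s :
  stalk_form (a *: s) = local_val a * stalk_form s.
Proof.
have [U [Ux [f [r [-> ->]]]]] := rgerm_sP a s.
by rewrite [X in stalk_form X]mkgermZE !stalk_formE local_valE formZ.
Qed.

Lemma stalk_form0 : stalk_form 0 = 0.
Proof. by apply: (addrI (stalk_form 0)); rewrite -stalk_formD !addr0. Qed.

Lemma stalk_form_germ (U : opens X) (s : F U) : oset U x ->
  stalk_form (germ x s) = form_fun phi s.
Proof. by move=> Ux; rewrite (germE Ux) stalk_formE. Qed.

Lemma stalk_form_sum m (s : 'I_m -> stalk F x) :
  stalk_form (\sum_i s i) = \sum_i stalk_form (s i).
Proof. exact: (big_morph _ stalk_formD stalk_form0). Qed.

End StalkForm.

Section PullForm.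
Variables (R : realType) (X Y : rspace R) (f : rmap X Y) (F : omod Y) (x : X).
Variable phi : fibre_form F (f x).

Definition tensor_form (l : seq (stalk F (f x) * local_ring x)) : R :=
  \sum_(mb <- l) stalk_form phi mb.1 * local_val mb.2.

(** The relation moving a scalar across the tensor is respected because a germ at [f x] and its
    pullback at x have the same value. *)
Lemma tensor_form_eq s t : tens_eq (local_pull f x) s t ->
  tensor_form s = tensor_form t.
Proof.
rewrite /tensor_form; elim=> {s t}.
- by [].
- by [].
- by move=> s t u _ -> _ ->.
- by move=> s s' t t' _ e _ e'; rewrite !big_cat e e'.
- by move=> s t; rewrite !big_cat /= addrC.
- by move=> b; rewrite big_seq1 big_nil stalk_form0 mul0r.
- by move=> m m' b; rewrite !(big_cons, big_nil) !addr0 stalk_formD mulrDl.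
- by move=> m b b'; rewrite !(big_cons, big_nil) !addr0 local_valD mulrDr.
- move=> a m b; rewrite !big_seq1 stalk_formZ local_valM local_val_pull.
  by rewrite mulrAC mulrC.
Qed.

Definition pull_stalk_form (t : pullback_stalk f F x) : R :=
  tensor_form (repr (t : base_change (local_pull f x) (stalk F (f x)))).

Lemma pull_stalk_form_pi l :
  pull_stalk_form (\pi_(base_change (local_pull f x) (stalk F (f x))) l) = tensor_form l.
Proof.
apply: tensor_form_eq; apply/asboolP/(@eqmodP _ (tens_equiv_rel _ _)).
exact: reprK.
Qed.

Lemma pull_stalk_form_tens m b : pull_stalk_form (tens (local_pull f x) m b) =
  stalk_form phi m * local_val b.
Proof. by rewrite pull_stalk_form_pi /tensor_form big_seq1. Qed.

Lemma pull_stalk_formD s t :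
  pull_stalk_form (s + t) = pull_stalk_form s + pull_stalk_form t.
Proof. by rewrite [s + t]/(bc_add s t) pull_stalk_form_pi /tensor_form big_cat. Qed.

Lemma pull_stalk_form0 : pull_stalk_form 0 = 0.
Proof. by apply: (addrI (pull_stalk_form 0)); rewrite -pull_stalk_formD !addr0. Qed.

Lemma pull_stalk_formZ c t :
  pull_stalk_form (c *: t) = local_val c * pull_stalk_form t.
Proof.
rewrite [c *: t]/(bc_scale c t) pull_stalk_form_pi /pull_stalk_form /tensor_form.
by rewrite big_map big_distrr; apply: eq_bigr => mb _ /=; rewrite local_valM mulrCA.
Qed.

Lemma pull_stalk_form_sum m (s : 'I_m -> pullback_stalk f F x) :
  pull_stalk_form (\sum_i s i) = \sum_i pull_stalk_form (s i).
Proof. exact: (big_morph _ pull_stalk_formD pull_stalk_form0). Qed.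

(** Again a fibre form, so [stalk_form] evaluates germs of the pullback. *)
Definition pull_form : fibre_form (pullback f F) x.
Proof.
exists (fun (U : opens X) (s : pullback f F U) => pull_stalk_form (pullback_fun s x)).
- by move=> U s t; exact: pull_stalk_formD.
- move=> U a s Ux.
  by rewrite [pullback_fun _ _]pullback_scaleE // pull_stalk_formZ local_val_fgerm.
- by move=> U V h s Vx; rewrite [pullback_fun _ _]pullback_resE.
Defined.

End PullForm.

(** Both sides are computed on the same representative sum of tensors. *)
Lemma pull_stalk_form_scale (R : realType) (X Y : rspace R) (f : rmap X Y) (F : omod Y)
    (x : X) (phi psi : fibre_form F (f x)) c t :
  (forall (U : opens Y) (s : F U), oset U (f x) -> c * form_fun phi s = form_fun psi s) ->
  c * pull_stalk_form phi t = pull_stalk_form psi t.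
Proof.
move=> h; rewrite /pull_stalk_form /tensor_form big_distrr; apply: eq_bigr => mb _ /=.
by rewrite mulrA /stalk_form h //; exact: pg_mem.
Qed.

Lemma zregular_sum (R : realType) (X : rspace R) (U : opens X) m (F : 'I_m -> X -> R) :
  (forall i, zregular U (F i)) -> zregular U (fun x => \sum_i F i x).
Proof.
move=> h; elim: (index_enum _) => [|i s IH].
  by apply: zregular_ext (zregular_cst 0 (opensP U)) _ => x _; rewrite big_nil.
have rN : zregular U (fun x => 0 - \sum_(j <- s) F j x).
  by apply: zregularB (opensP U) (zregular_cst 0 (opensP U)) _.
apply: zregular_ext (zregularB (opensP U) (h i) rN) _ => x _.
by rewrite big_cons sub0r opprK.
Qed.

(** * Components of sections of the pullback *)

Section FsumComp.
Variable R : realType.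

Definition Fsum_comp (b : bool) (k : nat) (V : opens (plane R)) (s : Fsum R V) :
  plane R -> R := fkl_comp b (dsum_fun s k).

Definition Fsum_form (b : bool) (k : nat) (y : plane R) : fibre_form (Fsum R) y.
Proof.
exists (fun V s => Fsum_comp b k s y).
- by move=> U s t; exact: fkl_compD.
- by move=> U a s Uy; exact: fkl_compZ.
- by move=> U V h s Vy; exact: fkl_comp_res.
Defined.

Variables (X : rspace R) (a : rmap X (plane R)).

Definition pull_comp (b : bool) (k : nat) (U : opens X) (t : pullback a (Fsum R) U) (x : X) : R :=
  form_fun (pull_form (Fsum_form b k (a x))) t.

(** Locally the section is a finite sum of tensors, so its component is a sum of pulled back
    components times regular functions. *)
Lemma pull_comp_regular (b : bool) (k : nat) (U : opens X) (t : pullback a (Fsum R) U) :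
  zregular (openI (preopen a (Ub R b)) U) (pull_comp b k t).
Proof.
apply: zregular_local (opensP _) _ => x [bx Ux].
have [V [W [m [s [g [VU Vx VW e]]]]]] := pullback_loc t Ux.
pose Z := openI (preopen a (openI (Ub R b) W)) V.
exists Z, (fun y => \sum_i Fsum_comp b k (s i) (a y) * g i y); split.
- exact: opensP.
- by split => //; split => //; exact: VW.
- by move=> y [[by_ _] Vy]; split => //; exact: VU.
- apply: zregular_sum => i; apply: (zregularM (opensP Z)).
    apply: (zregular_sub (U := preopen a (openI (Ub R b) W))); [exact: opensP|exact: opensP| |].
      by move=> y [].
    exact: (rmap_regular a (opensP (openI (Ub R b) W)) (fkl_comp_regular (b := b) (dsum_fun (s i) k))).
  by apply: zregular_sub (regfun_reg (g i)); [exact: opensP|exact: opensP|move=> y []].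
move=> y [[by_ Wy] Vy]; rewrite /pull_comp /= e // pull_stalk_form_sum.
apply: eq_bigr => i _.
by rewrite pull_stalk_form_tens stalk_form_germ // local_val_fgerm.
Qed.

Lemma pull_comp_glue (k : nat) (U : opens X) (t : pullback a (Fsum R) U) (x : X) :
  oset (U1 R) (a x) -> oset (U2 R) (a x) ->
  Pkl k.+1 k.+1 (a x) * pull_comp false k t x = pull_comp true k t x.
Proof.
move=> h1 h2; apply: pull_stalk_form_scale => V s Vx.
exact: fkl_glue_eq.
Qed.

Lemma pull_comp_unit (b : bool) (k : nat) : exists t : pullback a (Fsum R) (preopen a (Ub R b)),
  forall x, oset (Ub R b) (a x) -> pull_comp b k t x = 1.
Proof.
have [e he] := @fkl_comp_surj R b k.+1 k.+1 (Ub R b) 1 (@subset_refl _ _).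
(* The type of the summand depends on i, hence the cast along i = k. *)
pose s i : Fkl R i.+1 i.+1 (Ub R b) :=
  if i =P k is ReflectT ik then ecast i (Fkl R i.+1 i.+1 (Ub R b)) (esym ik) e else 0.
have hs : dsum_local s.
  move=> x Ux; exists (Ub R b), (@subset_refl _ _); split => //.
  apply: (sub_finite_set (B := [set k])); last exact: finite_set1.
  move=> i si; apply: contrapT => ik; apply: si.
  have -> : s i = 0 by rewrite /s; case: eqP.
  exact: res0.
pose es : Fsum R (Ub R b) := mkdsum hs.
have esE y : oset (Ub R b) y -> Fsum_comp b k es y = 1.
  move=> yb; rewrite /Fsum_comp /= /s; case: eqP => // ik.
  by rewrite (eq_axiomK ik) /= he // regfun_oneE.
pose t x : pullback_stalk a (Fsum R) x := tens (local_pull a x) (germ (a x) es) 1.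
have ht : pullback_local a (Fsum R) (preopen a (Ub R b)) t.
  move=> x Ux; exists (preopen a (Ub R b)), (Ub R b), 1%N, (fun=> es), (fun=> 1).
  by split => // y Uy; rewrite big_ord1 /t fgerm1.
exists (mkpullback ht) => x Ux.
transitivity (pull_stalk_form (Fsum_form b k (a x)) (t x)).
  by congr pull_stalk_form; exact: mkpullbackE.
rewrite pull_stalk_form_tens stalk_form_germ //.
by rewrite -(@fgerm1 _ _ x (openT X)) // local_val_fgerm // regfun_oneE // mulr1 -[RHS](esE _ Ux).
Qed.

Lemma along_Pkl k : along k (Pkl_poly R k k) = 0.
Proof.
rewrite /Pkl_poly rmorphD rmorphXn /= alongX alongC -exprMn mulnC exprM.
rewrite !rmorphXn rmorphM rmorphB /= map_polyX rmorph1 /branch exprZn sqr_i.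
by rewrite scaleN1r -exprM mulnC exprM addrN.
Qed.

(** The first component is finite along the branch at the point over (1, 0), and P vanishes on the
    branch. So the second component is zero along it, and its value at the point over (0, 0) is the
    limit 0. *)
Lemma pull_comp_vanishes sigma K : lifts_branches a sigma K ->
  exists2 x, oset (U2 R) (a x) &
    forall t : pullback a (Fsum R) (openT X), pull_comp true K t x = 0.
Proof.
move=> [sec dense pts].
have [x0 [ax0 l0]] := pts false; have [x1 [ax1 l1]] := pts true.
have e0 : (delta_mx 0 0 : 'rV[R]_2) != 0.
  by apply/eqP => /rowP/(_ 0)/eqP; rewrite !mxE oner_eq0.
have x0U : oset (Ub R true) (a x0).
  by rewrite /= ax0 scale0r eq_sym.
have x1U : oset (Ub R false) (a x1).
  by rewrite /= ax1 scale1r.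
have gU b : generic (fun u => oset (Ub R b) u).
  have [_ d _] := lifts_branches_id R; apply: d; first exact: opensP.
  by case: b; [exists (a x0) | exists (a x1)].
exists x0 => // t.
have oV b := opensP (openI (preopen a (Ub R b)) (openT X)).
have r b := @pull_comp_regular b K _ t.
have [p [q [hpq lpq]]] := l1 _ _ (oV false) (conj x1U I) (r false).
have [p' [q' [hpq' lpq']]] := l0 _ _ (oV true) (conj x0U I) (r true).
(* The gluing relation, valid at generic real points, becomes a polynomial identity and can be
   restricted to the complex branch. *)
have e : Pkl_poly R K.+1 K.+1 * p * q' = p' * q.
  apply/eqP; rewrite -subr_eq0; apply/eqP/generic_eq0.
  apply: generic2 (generic_and sec (generic_and (gU false) (gU true)))
    (generic_and hpq hpq') _ => u [su [u1 u2]] [/= h h'].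
  rewrite bevalB !bevalM beval_Pkl -h -h' -pull_comp_glue ?su //.
  by ring.
(* The summand of index K is F_(K+1,K+1), whose zero curve is the branch K + 1, beyond the
   threshold. *)
have hq := quot_lim_den (lpq K.+1 (leqnSn K)).
have l := lpq' K.+1 (leqnSn K).
apply: contrapT => /eqP c0; have /eqP := quot_lim_num l c0; apply.
have : along K.+1 p' * along K.+1 q = 0 by rewrite -rmorphM -e !rmorphM /= along_Pkl !mul0r.
by move/eqP; rewrite mulf_eq0 (negbTE hq) orbF => /eqP.
Qed.

End FsumComp.

Theorem corollary7p1 (R : realType) :
  [/\ quasi_coherent (Fsum R),
      locally_free_infinite (Fsum R) &
      forall (X : rspace R) (a : rmap X (plane R)),
        multi_blowup a -> ~ globally_generated (pullback a (Fsum R))].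
Proof.
split; [exact: Fsum_quasi_coherent | exact: Fsum_locally_free |].
move=> X a /multi_blowup_lifts[sigma [K la]] gg.
have [x xU hx] := pull_comp_vanishes la.
have [t ht] := pull_comp_unit a true K.
(* The component form gives 1 on the germ of [t] and 0 on every combination of germs of global
   sections. *)
have [m [c [s es]]] := gg x (germ x t).
have /eqP := oner_neq0 R; apply; rewrite -(ht x xU) /pull_comp.
rewrite -stalk_form_germ // es stalk_form_sum big1 // => i _.
by rewrite stalk_formZ stalk_form_germ // [form_fun _ _]hx mulr0.
Qed.
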